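(* Let $p>2$ be a prime, $\mathbf{F}$ a field of characteristic $p$, $M=(c_{ij})\in\mathbf{F}^{2\times2}$, and let $V_M$ be the associated three-dimensional representation of $G=(\mathbf{Z}/p)^2=\langle e_1,e_2\rangle$, so that $G$ acts on $\mathbf{F}[V_M]=\mathbf{F}[x,y,z]$ by algebra automorphisms with $x\cdot e_i=x$, $y\cdot e_i=y+c_{1i}x$, $z\cdot e_i=z+2c_{1i}y+(c_{1i}^2+c_{2i})x$ for $i=1,2$. Let $\overline\gamma_{ij}$, $\overline{f_1}$, $\overline{f_2}$, $N_G(z)$ be as defined in the context. If $\overline\gamma_{12}\neq0$ and $\overline\gamma_{13}\neq0$, then $\{x,\overline{f_1},\overline{f_2},N_G(z)\}$ is a SAGBI basis for $\mathbf{F}[V_M]^G$ with respect to the graded reverse lexicographic order with $x<y<z$. Furthermore, there is a single relation among the generators, constructed by subducting $\overline\gamma_{13}^{\,p}\,\overline{f_1}^{\,p+2}-\overline\gamma_{12}^{\,2}\,\overline{f_2}^{\,p}$.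
   Context: Let $\delta=y^2-xz$. Let $\overline\gamma_{ij}\in\mathbf{F}$ be the $2\times 2$ minor, on rows $i<j$, of the matrix with rows $(c_{11},c_{12})$, $(c_{21},c_{22})$, $(c_{11}^p,c_{12}^p)$, $(c_{21}^p,c_{22}^p)$ (rows $1$ to $4$). Define $$\overline{f_1}=\overline\gamma_{12}y^p+\overline\gamma_{13}\delta x^{p-2}+\overline\gamma_{23}yx^{p-1},\qquad \overline{f_2}=\frac{\overline{f_1}^{\,2}-\overline\gamma_{12}^{\,2}\delta^p+\overline\gamma_{12}\overline\gamma_{14}\delta x^{2p-2}+\overline\gamma_{12}\overline\gamma_{24}yx^{2p-1}}{2x^{p-2}},$$ where $\overline{f_2}$ is a polynomial; both are $G$-invariant. $N_G(z)$ is the product of the elements of the $G$-orbit of $z$. A subset $\mathcal{B}$ of a subalgebra $A$ of a polynomial ring is a SAGBI basis for $A$ if the lead monomials of the elements of $\mathcal{B}$ generate, as an algebra, the lead term algebra of $A$ (the algebra spanned by the lead monomials of nonzero elements of $A$); then $\mathcal{B}$ generates $A$. To subduct a polynomial $F$ over $\mathcal{B}$ is to repeatedly subtract from it scalar multiples of products of elements of $\mathcal{B}$ having the same lead term as the current polynomial; for a SAGBI basis, every $F\in A$ subducts to $0$. If $F$ is a polynomial expression in elements of $\mathcal{B}$, its subduction to $0$ yields an identity $F-\sum_I c_I\,b^I=0$ with products $b^I$ of elements of $\mathcal{B}$: this is the relation constructed by subducting $F$. ''A single relation'' means that the ideal of all algebraic relations among the listed generators is generated by that one relation. *)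

(* Defs.v *)
From HB Require Import structures.
From mathcomp Require Import all_boot all_order all_algebra all_fingroup.
From mathcomp Require Export mpoly.
From mathcomp Require Import ring zify.

Set Implicit Arguments.
Unset Strict Implicit.
Unset Printing Implicit Defensive.

Import GRing.Theory.
Local Open Scope ring_scope.

(* Graded reverse lexicographic order, with 'X_0 < 'X_1 < ... .           *)
(* The order that multinomials puts on 'X_{1..n} (used by mlead) is       *)
(* graded but compares exponents lexicographically, so it is not this one *)
(* in three or more variables.  In equal degree, the smaller monomial is  *)
(* the one with the larger exponent at the smallest variable at which the *)
(* two monomials differ.                                                  *)

Definition grevlex_lt n (m1 m2 : 'X_{1..n}) : bool :=
  (mdeg m1 < mdeg m2)%N ||
  (mdeg m1 == mdeg m2) &&
  [exists i : 'I_n, (m2 i < m1 i)%N &&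
     [forall j : 'I_n, (j < i)%N ==> (m1 j == m2 j)]].

Definition grevlex_max n (m1 m2 : 'X_{1..n}) : 'X_{1..n} :=
  if grevlex_lt m1 m2 then m2 else m1.

Section Sagbi.

Variables (F : fieldType) (n : nat).
Implicit Types (f g : {mpoly F[n]}) (A : {pred {mpoly F[n]}}).

(* 0%MM, the least monomial, when f = 0 *)
Definition lead_mon f : 'X_{1..n} :=
  \big[@grevlex_max n/0%MM]_(m <- msupp f) m.

Definition lead_term f : {mpoly F[n]} := f@_(lead_mon f) *: 'X_[lead_mon f].

Inductive subalg_gen (S : {mpoly F[n]} -> Prop) : {mpoly F[n]} -> Prop :=
| SubalgGen  f of S f : subalg_gen S f
| SubalgCst  (a : F) : subalg_gen S a%:MP
| SubalgAdd  f g of subalg_gen S f & subalg_gen S g : subalg_gen S (f + g)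
| SubalgMul  f g of subalg_gen S f & subalg_gen S g : subalg_gen S (f * g).

Inductive lin_span (S : {mpoly F[n]} -> Prop) : {mpoly F[n]} -> Prop :=
| SpanZero : lin_span S 0
| SpanStep (a : F) f g of S f & lin_span S g : lin_span S (a *: f + g).

Definition lead_monomials A : {mpoly F[n]} -> Prop :=
  fun h => exists2 f, f \in A & f != 0 /\ h = 'X_[lead_mon f].

Definition lead_term_algebra A : {mpoly F[n]} -> Prop :=
  lin_span (lead_monomials A).

Definition sagbi_basis A (B : seq {mpoly F[n]}) : Prop :=
  {subset B <= A} /\
  forall h, subalg_gen (lead_monomials (mem B)) h <-> lead_term_algebra A h.

(* Subduction over b_0, ..., b_(k-1), with the bookkeeping of what has been *)
(* subtracted: in subducts_to_zero b f Q, the polynomial Q is the sum of    *)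
(* the c *: 'X_[I], where c *: b^I are the successive subtracted terms and  *)
(* b^I = 'X_[I] \mPo b; thus f - (Q \mPo b) = 0.                            *)
Inductive subducts_to_zero k (b : k.-tuple {mpoly F[n]}) :
  {mpoly F[n]} -> {mpoly F[k]} -> Prop :=
| SubductDone : subducts_to_zero b 0 0
| SubductStep f (c : F) (I : 'X_{1..k}) Q of
    f != 0 &
    lead_term f = lead_term (c *: ('X_[I] \mPo b)) &
    subducts_to_zero b (f - c *: ('X_[I] \mPo b)) Q :
    subducts_to_zero b f (c *: 'X_[I] + Q).

(* R is a relation constructed by subducting the polynomial expression P *)
Definition subduction_relation k (b : k.-tuple {mpoly F[n]})
    (P R : {mpoly F[k]}) : Prop :=
  exists2 Q, subducts_to_zero b (P \mPo b) Q & R = P - Q.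

Definition generates_relations k (b : k.-tuple {mpoly F[n]})
    (R : {mpoly F[k]}) : Prop :=
  forall P : {mpoly F[k]}, P \mPo b = 0 <-> exists S, P = S * R.

End Sagbi.

(* Quotient of f by 'X_i ^+ k; terms not divisible by 'X_i ^+ k are dropped. *)
Definition divXn (F : fieldType) n (i : 'I_n) (k : nat) (f : {mpoly F[n]}) :
    {mpoly F[n]} :=
  \sum_(m <- msupp f | (k <= m i)%N) f@_m *: 'X_[m - U_(i) *+ k].

(* The matrix M = (c_ij) is c, with indices starting at 0; the generators   *)
(* e_1 and e_2 of (Z/p)^2 are indexed by 0 and 1.                           *)

Section Representation.

Variables (F : fieldType) (p : nat) (c : 'M[F]_2).

Definition vx : {mpoly F[3]} := 'X_(0 : 'I_3).
Definition vy : {mpoly F[3]} := 'X_(1 : 'I_3).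
Definition vz : {mpoly F[3]} := 'X_(2 : 'I_3).

Definition gen_images (i : 'I_2) : 3.-tuple {mpoly F[3]} :=
  [tuple vx;
         vy + c 0 i *: vx;
         vz + (2 * c 0 i) *: vy + (c 0 i ^+ 2 + c 1 i) *: vx].

Definition gen_act (i : 'I_2) (f : {mpoly F[3]}) : {mpoly F[3]} :=
  f \mPo gen_images i.

(* A right action, in which the pair (a, b) stands for e_1^a e_2^b; that it *)
(* is an action when F has characteristic p is VM_actD below.               *)
Definition VM_act (f : {mpoly F[3]}) (g : 'Z_p * 'Z_p) : {mpoly F[3]} :=
  iter g.2 (gen_act 1) (iter g.1 (gen_act 0) f).

Definition invariants : {pred {mpoly F[3]}} :=
  [pred f | [forall g, VM_act f g == f]].

Definition act_orbit (f : {mpoly F[3]}) : seq {mpoly F[3]} :=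
  undup [seq VM_act f g | g : 'Z_p * 'Z_p].

Definition orbit_norm (f : {mpoly F[3]}) : {mpoly F[3]} :=
  \prod_(h <- act_orbit f) h.

Definition gamma_rows : 'M[F]_(4, 2) :=
  col_mx c (map_mx (fun a => a ^+ p) c).

(* Rows are numbered from 0: gammabar 0 1 is the minor on the first two. *)
Definition gammabar (i j : 'I_4) : F :=
  \det (rowsub (fun k : 'I_2 => if k == 0 then i else j) gamma_rows).

Definition delta : {mpoly F[3]} := vy ^+ 2 - vx * vz.

Definition f1bar : {mpoly F[3]} :=
  gammabar 0 1 *: vy ^+ p
  + gammabar 0 2 *: (delta * vx ^+ (p - 2))
  + gammabar 1 2 *: (vy * vx ^+ (p - 1)).

Definition f2bar_num : {mpoly F[3]} :=
  f1bar ^+ 2 - gammabar 0 1 ^+ 2 *: delta ^+ p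
  + (gammabar 0 1 * gammabar 0 3) *: (delta * vx ^+ (2 * p - 2))
  + (gammabar 0 1 * gammabar 1 3) *: (vy * vx ^+ (2 * p - 1)).

(* The quotient is exact: see f2barE. *)
Definition f2bar : {mpoly F[3]} := 2^-1 *: divXn 0 (p - 2) f2bar_num.

Definition basisV : 4.-tuple {mpoly F[3]} :=
  [tuple vx; f1bar; f2bar; orbit_norm vz].

(* gammabar_13^p T_1^(p+2) - gammabar_12^2 T_2^p, where T_0, ..., T_3 stand *)
(* for x, f1bar, f2bar, N_G(z)                                              *)
Definition subducted_expr : {mpoly F[4]} :=
  gammabar 0 2 ^+ p *: 'X_(1 : 'I_4) ^+ (p + 2)
  - gammabar 0 1 ^+ 2 *: 'X_(2 : 'I_4) ^+ p.

End Representation.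

Lemma gammabarE (F : fieldType) p (c : 'M[F]_2) i j :
  gammabar p c i j =
    gamma_rows p c i 0 * gamma_rows p c j 1
    - gamma_rows p c i 1 * gamma_rows p c j 0.
Proof.
rewrite /gammabar (expand_det_row _ 0) !big_ord_recl big_ord0 /cofactor !det_mx11.
have mE k l : rowsub (fun k : 'I_2 => if k == 0 then i else j)
    (gamma_rows p c) k l = gamma_rows p c (if k == 0 then i else j) l.
  by rewrite mxE.
have rE (A : 'M[F]_2) u v k l : row' u (col' v A) k l = A (lift u k) (lift v l).
  by rewrite !mxE.
rewrite !rE !mE /= /bump /= !(expr0, expr1) mul1r mulN1r addr0 mulrN.
have -> : lift ord0 ord0 = 1 :> 'I_2 by apply: val_inj.
have -> : lift 1 0 = 0 :> 'I_2 by apply: val_inj.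
by [].
Qed.

Lemma gammabar_explicit (F : fieldType) p (c : 'M[F]_2) :
  gammabar p c 0 1 = c 0 0 * c 1 1 - c 0 1 * c 1 0 /\
  gammabar p c 0 2 = c 0 0 * c 0 1 ^+ p - c 0 1 * c 0 0 ^+ p /\
  gammabar p c 0 3 = c 0 0 * c 1 1 ^+ p - c 0 1 * c 1 0 ^+ p /\
  gammabar p c 1 2 = c 1 0 * c 0 1 ^+ p - c 1 1 * c 0 0 ^+ p /\
  gammabar p c 1 3 = c 1 0 * c 1 1 ^+ p - c 1 1 * c 1 0 ^+ p.
Proof.
pose cp := map_mx (fun a => a ^+ p) c.
have rows (i : 'I_4) (k : 'I_(2 + 2)) j :
  val i = val k -> gamma_rows p c i j = col_mx c cp k j.
  by move=> /val_inj ->.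
have r0 j : gamma_rows p c 0 j = c 0 j.
  by rewrite (rows _ (lshift 2 0)) ?col_mxEu.
have r1 j : gamma_rows p c 1 j = c 1 j.
  by rewrite (rows _ (lshift 2 1)) ?col_mxEu.
have r2 j : gamma_rows p c 2 j = c 0 j ^+ p.
  by rewrite (rows _ (rshift 2 0)) ?col_mxEd ?mxE.
have r3 j : gamma_rows p c 3 j = c 1 j ^+ p.
  by rewrite (rows _ (rshift 2 1)) ?col_mxEd ?mxE.
by rewrite !gammabarE !r0 !r1 !r2 !r3.
Qed.

Section Grevlex.

Variable n : nat.
Implicit Types m : 'X_{1..n}.

Lemma grevlex_lt_trans m2 m1 m3 :
  grevlex_lt m1 m2 -> grevlex_lt m2 m3 -> grevlex_lt m1 m3.
Proof.
rewrite /grevlex_lt => /orP[d12|/andP[/eqP d12 /existsP[i /andP[l12 /forallP e12]]]].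
  case/orP=> [d23|/andP[/eqP <- _]]; last by rewrite d12.
  by rewrite (ltn_trans d12 d23).
rewrite d12; case/orP=> [->//|/andP[-> /existsP[j /andP[l23 /forallP e23]]]].
apply/orP; right; apply/existsP.
have [lij|lji|/val_inj eij] := ltngtP i j.
- exists i; move/implyP/(_ lij)/eqP: (e23 i) => <-; rewrite l12.
  apply/forallP=> k; apply/implyP=> lki.
  by rewrite (eqP (implyP (e12 k) lki)) (implyP (e23 k) (ltn_trans lki lij)).
- exists j; move/implyP/(_ lji)/eqP: (e12 j) => ->; rewrite l23.
  apply/forallP=> k; apply/implyP=> lkj.
  by rewrite (eqP (implyP (e12 k) (ltn_trans lkj lji))) (implyP (e23 k) lkj).
- subst j; exists i; rewrite (ltn_trans l23 l12); apply/forallP=> k.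
  apply/implyP=> lki.
  by rewrite (eqP (implyP (e12 k) lki)) (implyP (e23 k) lki).
Qed.

Lemma grevlex_lt_irr m : grevlex_lt m m = false.
Proof.
by rewrite /grevlex_lt ltnn eqxx /=; apply/existsP=> -[i]; rewrite ltnn.
Qed.

Lemma grevlex_lt_total m1 m2 :
  [|| grevlex_lt m1 m2, m1 == m2 | grevlex_lt m2 m1].
Proof.
rewrite /grevlex_lt; case: (ltngtP (mdeg m1) (mdeg m2)) => //= d12;
  rewrite ?orbT //.
have [//|ne12] := boolP (m1 == m2); rewrite ?orbT //=.
have [i nei] : exists i, m1 i != m2 i.
  apply/existsP; apply: contraR ne12; rewrite negb_exists => /forallP e12.
  by apply/eqP/mnmP=> i; apply/eqP; move: (e12 i); rewrite negbK.
case: (@arg_minnP _ i (fun j => m1 j != m2 j) val nei) => j nej jmin.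
have e12 (k : 'I_n) : (k < j)%N -> m1 k = m2 k.
  by move=> lkj; apply/eqP; apply: contraLR lkj => /jmin; rewrite -leqNgt.
move: nej; rewrite neq_ltn => /orP[l12|l21]; apply/orP; [right|left];
  apply/existsP; exists j; rewrite ?l12 ?l21;
  by apply/forallP=> k; apply/implyP=> /e12 ->.
Qed.

Lemma grevlex_lt0 m : m != 0%MM -> grevlex_lt 0%MM m.
Proof. by rewrite /grevlex_lt mdeg0 lt0n mdeg_eq0 => ->. Qed.

Lemma lead_mon_mem (F : fieldType) (f : {mpoly F[n]}) :
  f != 0 -> lead_mon f \in msupp f.
Proof.
rewrite -msupp_eq0 /lead_mon; elim: (msupp f) => // m s IHs _.
rewrite big_cons /grevlex_max inE; case: ifP => [l|]; last by rewrite eqxx.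
have [s0|/IHs->] := eqVneq s [::]; last by rewrite orbT.
move: l; rewrite s0 big_nil.
have [->|/grevlex_lt0 l0 /(grevlex_lt_trans l0)] := eqVneq m 0%MM.
  by rewrite grevlex_lt_irr.
by rewrite grevlex_lt_irr.
Qed.

Lemma lead_mon_max (F : fieldType) (f : {mpoly F[n]}) m :
  m \in msupp f -> m != lead_mon f -> grevlex_lt m (lead_mon f).
Proof.
rewrite /lead_mon; elim: (msupp f) => // m' s IHs.
rewrite big_cons /grevlex_max inE; set M := \big[_/_]_(_ <- s) _.
rewrite -/M in IHs; case: ifP => l /orP[/eqP->|ms] ne //; last 1 first.
- have lM : grevlex_lt M m' || (M == m').
    by move: (grevlex_lt_total m' M); rewrite l /= orbC eq_sym.
  have [eM|neM] := eqVneq m M.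
    by move: lM; rewrite -eM (negPf ne) orbF.
  by case/orP: lM => [/(grevlex_lt_trans (IHs ms neM))|/eqP<-] //; exact: IHs.
- exact: IHs.
- by rewrite eqxx in ne.
Qed.

End Grevlex.

Section Action.

Variables (F : fieldType) (p : nat) (c : 'M[F]_2).
Hypotheses (p_prime : prime p) (charFp : p \in [pchar F]).

Lemma gen_act_gen i :
  [/\ gen_act c i (vx F) = vx F,
      gen_act c i (vy F) = vy F + c 0 i *: vx F &
      gen_act c i (vz F) =
        vz F + (2 * c 0 i) *: vy F + (c 0 i ^+ 2 + c 1 i) *: vx F].
Proof. by rewrite /gen_act !comp_mpolyXU. Qed.

Definition shear (s t : F) : 3.-tuple {mpoly F[3]} :=
  [tuple vx F; vy F + s *: vx F;
         vz F + (2 * s) *: vy F + (s ^+ 2 + t) *: vx F].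

Lemma comp_mpoly_comp (lp lq : 3.-tuple {mpoly F[3]}) (P : {mpoly F[3]}) :
  (P \mPo lp) \mPo lq = P \mPo [tuple tnth lp i \mPo lq | i < 3].
Proof.
rewrite (comp_mpolyEX P lp) raddf_sum [RHS]comp_mpolyEX; apply: eq_bigr => m _ /=.
rewrite comp_mpolyZ !comp_mpolyX rmorph_prod; congr (_ *: _).
by apply: eq_bigr => i _; rewrite rmorphXn tnth_mktuple.
Qed.

Lemma comp_shear s t s' t' (P : {mpoly F[3]}) :
  (P \mPo shear s t) \mPo shear s' t' = P \mPo shear (s + s') (t + t').
Proof.
rewrite comp_mpoly_comp; congr (_ \mPo _); apply: eq_from_tnth => i.
rewrite tnth_mktuple; case: i => [[|[|[|//]]] lti];
  rewrite !(tnth_nth 0) /= !(comp_mpolyXU, comp_mpolyD, comp_mpolyZ) //=.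
- by rewrite -addrA -scalerDl [s' + s]addrC.
- by rewrite -!mul_mpolyC !(rmorphD, rmorphM, rmorphXn) /= ?rmorph_nat; ring.
Qed.

Lemma VM_actE (P : {mpoly F[3]}) (g : 'Z_p * 'Z_p) :
  VM_act c P g =
    P \mPo shear (c 0 0 *+ g.1 + c 0 1 *+ g.2) (c 1 0 *+ g.1 + c 1 1 *+ g.2).
Proof.
have it i k Q : iter k (gen_act c i) Q = Q \mPo shear (c 0 i *+ k) (c 1 i *+ k).
  elim: k => [|k /= ->].
    rewrite -[LHS]comp_mpoly_id; congr (_ \mPo _); apply: eq_from_tnth => j.
    rewrite tnth_mktuple; case: j => [[|[|[|//]]] ltj];
      rewrite !(tnth_nth 0) /= ?mulr0 ?expr0n ?addr0 ?scale0r ?addr0;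
      by congr mpolyX; congr mnmd; apply: val_inj.
  by rewrite /gen_act comp_shear -!mulrSr.
by rewrite /VM_act !it comp_shear.
Qed.

Lemma VM_act0 (P : {mpoly F[3]}) : VM_act c P (0 : 'Z_p * 'Z_p) = P.
Proof. by []. Qed.

Lemma VM_actD (P : {mpoly F[3]}) (g h : 'Z_p * 'Z_p) :
  VM_act c P (g + h) = VM_act c (VM_act c P g) h.
Proof.
have modE (a : F) k : a *+ (k %% (Zp_trunc p).+2) = a *+ k.
  rewrite Zp_cast ?prime_gt1 // [in RHS](divn_eq k p) mulrnDr mulnC mulrnA.
  by rewrite -[a *+ p]mulr_natr (pcharf0 charFp) mulr0 mul0rn add0r.
have Zpadd (a : F) (u v : 'Z_p) : a *+ (u + v)%R = a *+ u + a *+ v.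
  by rewrite modE mulrnDr.
by rewrite !VM_actE comp_shear /= !Zpadd; congr (_ \mPo shear _ _); ring.
Qed.

Lemma VM_act_gen (P : {mpoly F[3]}) :
  VM_act c P ((1, 0) : 'Z_p * 'Z_p) = gen_act c 0 P /\
  VM_act c P ((0, 1) : 'Z_p * 'Z_p) = gen_act c 1 P.
Proof. by []. Qed.

Lemma VM_act_mul (P Q : {mpoly F[3]}) (g : 'Z_p * 'Z_p) :
  VM_act c (P * Q) g = VM_act c P g * VM_act c Q g.
Proof. by rewrite !VM_actE rmorphM. Qed.

Lemma invariants_subalg : subalg_closed (invariants p c).
Proof.
split; first by apply/forallP=> g; rewrite VM_actE rmorph1.
- move=> a u v /forallP iu /forallP iv; apply/forallP=> g.
  rewrite VM_actE linearP /= -!VM_actE; by rewrite (eqP (iu g)) (eqP (iv g)).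
- move=> u v /forallP iu /forallP iv; apply/forallP=> g.
  by rewrite VM_act_mul (eqP (iu g)) (eqP (iv g)).
Qed.

End Action.

Section Division.

Variable F : fieldType.

Lemma divXn_mulX n (i : 'I_n) k (f : {mpoly F[n]}) :
  divXn i k ('X_i ^+ k * f) = f.
Proof.
rewrite /divXn mpolyXn mulrC (perm_big _ (msuppMX _ _)) /= big_map.
rewrite [RHS]mpolyE big_seq_cond [RHS]big_seq_cond.
apply: eq_big => [m|m _].
  by rewrite mnmDE mulmnE mnm1E eqxx mul1n leq_addr andbT.
by rewrite mcoeffMX addmC addmK.
Qed.

Lemma f2barE p (c : 'M[F]_2) (p_prime : prime p) (p_gt2 : (2 < p)%N)
    (charFp : p \in [pchar F]) :
  2 *: (vx F ^+ (p - 2) * f2bar p c) = f2bar_num p c.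
Proof.
have two_neq0 : (2 : F) != 0.
  by rewrite -(dvdn_pcharf charFp) gtnNdvd.
suff [q eq_q] : exists q, f2bar_num p c = vx F ^+ (p - 2) * q.
  by rewrite /f2bar eq_q divXn_mulX -scalerAr scalerA mulfV // scale1r.
have charP : p \in [pchar {mpoly F[3]}] by rewrite pchar_lalg.
have eD : delta F ^+ p = vy F ^+ p * vy F ^+ p - vx F ^+ p * vz F ^+ p.
  rewrite /delta -[LHS](pFrobenius_autE charP) pFrobenius_autB_comm; last exact: mulrC.
  by rewrite !pFrobenius_autE !exprMn.
rewrite /f2bar_num eD /f1bar -!mul_mpolyC rmorphXn !rmorphM /=.
move: (gammabar p c 0 1) (gammabar p c 0 2) (gammabar p c 1 2)
      (gammabar p c 0 3) (gammabar p c 1 3) => a b e d h.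
have -> : vx F ^+ p = vx F ^+ 2 * vx F ^+ (p - 2).
  by rewrite -exprD subnKC // ltnW.
have -> : vx F ^+ (p - 1) = vx F * vx F ^+ (p - 2).
  by rewrite -exprS -subSn // ltnW.
have -> : vx F ^+ (2 * p - 2) = vx F ^+ 2 * vx F ^+ (p - 2) * vx F ^+ (p - 2).
  by rewrite -!exprD; congr (_ ^+ _); lia.
have -> : vx F ^+ (2 * p - 1) = vx F ^+ 3 * vx F ^+ (p - 2) * vx F ^+ (p - 2).
  by rewrite -!exprD; congr (_ ^+ _); lia.
move: (vx F) (vx F ^+ (p - 2)) (vy F) (vy F ^+ p) (vz F ^+ p) (delta F).
move=> x X y Y Z D; rewrite /=.
exists (a%:MP ^+ 2 * x ^+ 2 * Z
  + 2 * a%:MP * Y * (b%:MP * D + e%:MP * y * x)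
  + X * (b%:MP * D + e%:MP * y * x) ^+ 2
  + a%:MP * d%:MP * D * x ^+ 2 * X + a%:MP * h%:MP * y * x ^+ 3 * X).
ring.
Qed.

End Division.

(* Main.v *)
Require Import Defs.
From HB Require Import structures.
From mathcomp Require Import all_boot all_order all_algebra.
From mathcomp Require Import ring zify.

(**
Write a, b for gammabar_12, gammabar_13.  In grevlex with x < y < z the lead
monomials of the generators are x, y^p, y^(p+2) and z^(p^2), and since p is odd
the monomials T^m in the generators with T_2-exponent less than p have pairwise
distinct lead monomials.  Call a combination of those a normal form.

Since the action fixes x, put y = x u and z = x (u^2 - w).  Then f1 = x^p A with
A = a u^p + b w + gammabar_23 u, and b <> 0 lets one trade w for A: over F[x, A]
everything is a polynomial in the single variable u, on which the group acts by
p^2 distinct translations.  A translation-invariant polynomial in u is a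
polynomial in any invariant one of degree p^2 in u with constant lead
coefficient, and f2 / x^(p+2) is one.  So every invariant becomes, after
multiplication by a power of x, a polynomial in x, f1, f2.  As N_G(z) / x^(p^2)
has degree p^3 in u with constant lead coefficient, it is a polynomial of degree
exactly p in f2 / x^(p+2); this expresses x^K f2^p as a normal form.

Finally, if x f is a normal form then so is f: the part of the normal form not
involving x is divisible by x, while its lead monomial is not, so it vanishes.
Hence f2^p, and then every invariant, is a normal form.  The subduction only
subtracts monomials whose lead monomial is below y^(p(p+2)), and these are in
normal form, so the resulting relation is of degree p in T_2 with constant lead
coefficient; division by it reduces any relation to one in normal form, that is,
to zero.
*)

Set Implicit Arguments.
Unset Strict Implicit.
Unset Printing Implicit Defensive.

Import GRing.Theory.
Local Open Scope ring_scope.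

(** * Lead terms *)

Section LeadTerms.

Variables (F : fieldType) (n : nat).
Implicit Types (m : 'X_{1..n}) (f g : {mpoly F[n]}).

Lemma grevlex_ltD2r m m1 m2 :
  grevlex_lt (m1 + m)%MM (m2 + m)%MM = grevlex_lt m1 m2.
Proof.
rewrite /grevlex_lt !mdegD ltn_add2r eqn_add2r; congr (_ || _ && _).
apply: eq_existsb => i; rewrite !mnmDE ltn_add2r; congr (_ && _).
by apply: eq_forallb => j; rewrite !mnmDE eqn_add2r.
Qed.

Lemma grevlex_ltD2l m m1 m2 :
  grevlex_lt (m + m1)%MM (m + m2)%MM = grevlex_lt m1 m2.
Proof. by rewrite ![(m + _)%MM]addmC grevlex_ltD2r. Qed.

Lemma grevlex_ltD m1 m2 m3 m4 :
  grevlex_lt m1 m2 -> grevlex_lt m3 m4 -> grevlex_lt (m1 + m3)%MM (m2 + m4)%MM.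
Proof.
by move=> l12 l34; apply: (@grevlex_lt_trans _ (m2 + m3)%MM);
  rewrite ?grevlex_ltD2r ?grevlex_ltD2l.
Qed.

(** A bound on the whole support instead of on [lead_mon f]: the zero polynomial satisfies it for
    every [m], so cancellation needs no case distinction. *)
Definition below m f := forall m', m' \in msupp f -> grevlex_lt m' m.

Lemma below0 m : below m 0.
Proof. by move=> m'; rewrite msupp0. Qed.

Lemma belowD m f g : below m f -> below m g -> below m (f + g).
Proof.
by move=> bf bg m' /msuppD_le; rewrite mem_cat => /orP[/bf|/bg].
Qed.

Lemma belowZ m a f : below m f -> below m (a *: f).
Proof. by move=> bf m' /msuppZ_le /bf. Qed.

Lemma belowN m f : below m f -> below m (- f).
Proof. by rewrite -scaleN1r; apply: belowZ. Qed.

Lemma below_sum (I : Type) (r : seq I) (P : pred I) (G : I -> {mpoly F[n]}) m :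
  (forall i, P i -> below m (G i)) -> below m (\sum_(i <- r | P i) G i).
Proof. by move=> bG; elim/big_rec: _ => [|i f Pi bf]; [apply: below0|apply: belowD; [apply: bG|]]. Qed.

Lemma belowX m m' : grevlex_lt m m' -> below m' 'X_[m].
Proof. by move=> l m2; rewrite msuppX inE => /eqP->. Qed.

Lemma below_trans m m' f : grevlex_lt m m' -> below m f -> below m' f.
Proof. by move=> l bf m2 /bf /grevlex_lt_trans; apply. Qed.

Lemma belowM m m' f g : below m f -> below m' g -> below (m + m')%MM (f * g).
Proof.
move=> bf bg k /msuppM_le /allpairsP[[k1 k2] /= [/bf l1 /bg l2 ->]].
exact: grevlex_ltD.
Qed.

Lemma belowMX m m' f : below m f -> below (m + m')%MM (f * 'X_[m']).
Proof.
move=> bf k /msuppM_le /allpairsP[[k1 k2] /= [/bf l1]].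
by rewrite msuppX inE => /eqP-> ->; rewrite grevlex_ltD2r.
Qed.

(* [a] may be zero, in which case this only says [below m f]. *)
Definition has_lead f m (a : F) := below m (f - a *: 'X_[m]).

Lemma has_leadX m : has_lead 'X_[m] m 1.
Proof. by rewrite /has_lead scale1r subrr; apply: below0. Qed.

Lemma has_leadC (a : F) : has_lead a%:MP 0%MM a.
Proof. by rewrite /has_lead mpolyX0 alg_mpolyC subrr; apply: below0. Qed.

Lemma has_leadDl f g m a : has_lead f m a -> below m g -> has_lead (f + g) m a.
Proof. by move=> lf bg; rewrite /has_lead addrAC; apply: belowD. Qed.

Lemma has_leadD f g m a b :
  has_lead f m a -> has_lead g m b -> has_lead (f + g) m (a + b).
Proof.
by move=> lf lg; rewrite /has_lead scalerDl opprD addrACA; apply: belowD.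
Qed.

Lemma has_leadZ f m a b : has_lead f m a -> has_lead (b *: f) m (b * a).
Proof. by move=> lf; rewrite /has_lead -scalerA -scalerBr; apply: belowZ. Qed.

Lemma has_leadM f g m m' a b :
  has_lead f m a -> has_lead g m' b -> has_lead (f * g) (m + m')%MM (a * b).
Proof.
move=> lf lg; rewrite /has_lead.
have -> : f * g - (a * b) *: 'X_[m + m'] =
    (f - a *: 'X_[m]) * (g - b *: 'X_[m']) + b *: ((f - a *: 'X_[m]) * 'X_[m'])
    + a *: ((g - b *: 'X_[m']) * 'X_[m]).
  by rewrite mpolyXD -!mul_mpolyC rmorphM /=; ring.
apply: belowD; first by apply: belowD; [apply: belowM|apply/belowZ/belowMX].
by apply: belowZ; rewrite addmC; apply: belowMX.
Qed.

Lemma has_leadXn f m a k : has_lead f m a -> has_lead (f ^+ k) (m *+ k)%MM (a ^+ k).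
Proof.
move=> lf; elim: k => [|k IHk]; first by rewrite mulm0n !expr0; apply: has_leadC.
by rewrite !exprS mulmS; apply: has_leadM.
Qed.

Lemma has_lead_mpolyXn m k : has_lead ('X_[m] ^+ k) (m *+ k)%MM 1.
Proof. by have := has_leadXn (k := k) (@has_leadX m); rewrite expr1n. Qed.

Lemma has_lead_prod (I : Type) (r : seq I) (G : I -> {mpoly F[n]}) m :
  (forall i, has_lead (G i) m 1) ->
  has_lead (\prod_(i <- r) G i) (m *+ size r)%MM 1.
Proof.
move=> lG; elim: r => [|i r IHr]; first by rewrite big_nil mulm0n; apply: has_leadC.
by rewrite big_cons /= mulmS; have := has_leadM (lG i) IHr; rewrite mulr1.
Qed.

Lemma has_lead_below f m m' a : has_lead f m a -> grevlex_lt m m' -> below m' f.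
Proof.
move=> lf l; rewrite -[f](subrK (a *: 'X_[m])); apply: belowD.
  exact: below_trans l lf.
exact/belowZ/belowX.
Qed.

Lemma has_lead0_below f m : has_lead f m 0 -> below m f.
Proof. by rewrite /has_lead scale0r subr0. Qed.

Lemma has_lead_coef f m a : has_lead f m a -> f@_m = a.
Proof.
move=> lf; apply/eqP; rewrite -subr_eq0; apply: contraT => ne.
have : m \in msupp (f - a *: 'X_[m]).
  by rewrite mcoeff_msupp mcoeffB mcoeffZ mcoeffX eqxx mulr1.
by move/lf; rewrite grevlex_lt_irr.
Qed.

Lemma has_lead_mon f m a : a != 0 -> has_lead f m a -> f != 0 /\ lead_mon f = m.
Proof.
move=> a0 lf; have cf := has_lead_coef lf.
have mf : m \in msupp f by rewrite mcoeff_msupp cf.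
have f0 : f != 0 by apply: contraTneq mf => ->; rewrite msupp0.
split=> //; apply/eqP; rewrite eq_sym; apply: contraT => ne.
have lt1 := lead_mon_max mf ne.
have : grevlex_lt (lead_mon f) m.
  apply: lf; rewrite mcoeff_msupp mcoeffB mcoeffZ mcoeffX (negPf ne) mulr0 subr0.
  by rewrite -mcoeff_msupp lead_mon_mem.
by move/(grevlex_lt_trans lt1); rewrite grevlex_lt_irr.
Qed.

Lemma lead_mon_has_lead f : has_lead f (lead_mon f) f@_(lead_mon f).
Proof.
move=> m; rewrite mcoeff_msupp mcoeffB mcoeffZ mcoeffX.
have [<-|ne] := eqVneq (lead_mon f) m; first by rewrite mulr1 subrr eqxx.
rewrite mulr0 subr0 -mcoeff_msupp => mf; apply: lead_mon_max => //.
by rewrite eq_sym.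
Qed.

Lemma lead_monM f g : f != 0 -> g != 0 ->
  lead_mon (f * g) = (lead_mon f + lead_mon g)%MM.
Proof.
move=> f0 g0; have lfg := has_leadM (@lead_mon_has_lead f) (@lead_mon_has_lead g).
have [|//] := has_lead_mon _ lfg.
by rewrite mulf_neq0 // -mcoeff_msupp lead_mon_mem.
Qed.

Lemma has_lead_term f m a : a != 0 -> has_lead f m a -> lead_term f = a *: 'X_[m].
Proof.
by move=> a0 lf; rewrite /lead_term (has_lead_mon a0 lf).2 (has_lead_coef lf).
Qed.

End LeadTerms.

Arguments has_leadX {F n} m.
Arguments has_leadZ {F n f m a} b.
Arguments has_leadXn {F n f m a} k.

(** * Polynomial expressions in a family with known lead terms *)

(** Injectivity excludes ties, so the largest value is attained once and strictly dominates the
    others; this singles out the leading term of a polynomial expression. *)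
Lemma grevlex_argmax n (T : eqType) (r : seq T) (f : T -> 'X_{1..n}) :
  r != [::] -> {in r &, injective f} ->
  exists2 x, x \in r & forall y, y \in r -> y != x -> grevlex_lt (f y) (f x).
Proof.
elim: r => // x [|x' r] IHr _ inj_f.
  by exists x => [|y]; rewrite inE // => /eqP->; rewrite eqxx.
have [y z ys zs|y ys ymax] := IHr isT.
  by apply: inj_f; rewrite in_cons ?ys ?zs orbT.
have yxs : y \in x :: x' :: r by rewrite in_cons ys orbT.
have [exy|nexy] := eqVneq x y.
  by exists y => // z; rewrite in_cons exy => /orP[/eqP->|]; [rewrite eqxx|apply: ymax].
case/or3P: (grevlex_lt_total (f x) (f y)) => [lxy|/eqP fxy|lyx].
- exists y => // z; rewrite in_cons => /orP[/eqP-> //|]; exact: ymax.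
- by case/negP: nexy; apply/eqP/inj_f; rewrite ?mem_head.
exists x => [|z]; first by rewrite mem_head.
rewrite in_cons => /orP[/eqP->|zs _]; first by rewrite eqxx.
by have [->//|/(ymax _ zs)/grevlex_lt_trans] := eqVneq z y; apply.
Qed.

Section Expressions.

Variables (F : fieldType) (n k : nat) (b : k.-tuple {mpoly F[n]}).
Variables (e : 'I_k -> 'X_{1..n}) (a : 'I_k -> F).
Hypotheses (lead_b : forall i, has_lead (tnth b i) (e i) (a i))
           (a_neq0 : forall i, a i != 0).
Implicit Types (m : 'X_{1..k}) (P Q : {mpoly F[k]}).

Definition lead_expo m := (\big[mnm_add/0%MM]_(i < k) (e i *+ m i))%MM.
Definition lead_cst m := \prod_(i < k) a i ^+ m i.

Lemma lead_cst_neq0 m : lead_cst m != 0.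
Proof. by apply/prodf_neq0 => i _; rewrite expf_neq0. Qed.

Lemma has_lead_compX m : has_lead ('X_[m] \mPo b) (lead_expo m) (lead_cst m).
Proof.
rewrite comp_mpolyX /lead_expo /lead_cst.
elim/big_rec3: _ => [|i c m' f _ lf]; first exact: has_leadC.
by apply: has_leadM => //; apply: has_leadXn.
Qed.

(** Products with pairwise distinct lead monomials cannot cancel at the top, so the largest of these
    monomials leads the sum. *)
Lemma has_lead_comp P : P != 0 -> {in msupp P &, injective lead_expo} ->
  exists2 m, m \in msupp P &
    has_lead (P \mPo b) (lead_expo m) (P@_m * lead_cst m).
Proof.
rewrite -msupp_eq0 => P0 inj_e; have [m mP m_max] := grevlex_argmax P0 inj_e.
exists m => //; rewrite comp_mpolyEX (bigD1_seq m) ?msupp_uniq //=.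
apply: has_leadDl; first exact/has_leadZ/has_lead_compX.
rewrite big_seq_cond; apply: below_sum => m' /andP[m'P ne].
by apply/belowZ/has_lead_below; [apply: has_lead_compX|apply: m_max].
Qed.

Lemma comp_mpoly_inj P : {in msupp P &, injective lead_expo} ->
  P \mPo b = 0 -> P = 0.
Proof.
move=> inj_e Pb0; apply/eqP; apply: contraT => /has_lead_comp/(_ inj_e)[m mP lP].
have [|] := has_lead_mon _ lP; last by rewrite Pb0 eqxx.
by rewrite mulf_neq0 ?lead_cst_neq0 // -mcoeff_msupp.
Qed.

(** Each subduction step removes from [P] the term whose lead monomial is largest; the induction is
    on the number of terms. *)
Lemma subducts_to_zero_comp P : {in msupp P &, injective lead_expo} ->
  subducts_to_zero b (P \mPo b) P.
Proof.
elim: {P}(size _) {-2}P (erefl (size (msupp P))) => [|s IHs] P sP inj_e.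
  have -> : P = 0 by apply/eqP; rewrite -msupp_eq0 -size_eq0 sP.
  by rewrite comp_mpoly0; apply: SubductDone.
have P0 : P != 0 by rewrite -msupp_eq0 -size_eq0 sP.
have [m mP lP] := has_lead_comp P0 inj_e.
have c0 : P@_m * lead_cst m != 0 by rewrite mulf_neq0 ?lead_cst_neq0 // -mcoeff_msupp.
rewrite -[X in subducts_to_zero _ _ X](subrKC (P@_m *: 'X_[m])).
apply: SubductStep.
- exact: (has_lead_mon c0 lP).1.
- by rewrite (has_lead_term c0 lP) (has_lead_term c0 (has_leadZ P@_m (@has_lead_compX m))).
rewrite -comp_mpolyZ -comp_mpolyB; apply: IHs.
  by rewrite (perm_size (msupp_rem _ _)) size_rem // sP.
by apply: sub_in2 inj_e => m'; rewrite (perm_mem (msupp_rem _ _)) => /mem_rem.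
Qed.

Lemma subducts_to_zeroE f P : subducts_to_zero b f P -> f = P \mPo b.
Proof.
elim=> [|g c I Q _ _ _ IH]; first by rewrite comp_mpoly0.
by rewrite comp_mpolyD comp_mpolyZ -IH addrC subrK.
Qed.

(** A subtracted product shares the lead monomial of the current polynomial, hence lies below [M],
    and subtracting it preserves the bound. *)
Lemma subducts_to_zero_below M f P : subducts_to_zero b f P -> below M f ->
  forall m, m \in msupp P -> grevlex_lt (lead_expo m) M.
Proof.
elim=> [_ m|g c I Q g0 lg _ IH bg m]; first by rewrite msupp0.
have lI : lead_mon g = lead_expo I /\ c != 0.
  (* A zero scalar [c] would make the lead term of the nonzero [g] vanish. *)
  have lt0 : lead_term g != 0.
    rewrite /lead_term scaler_eq0 negb_or -mcoeff_msupp lead_mon_mem //=.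
    by rewrite -msupp_eq0 msuppX.
  have c0 : c != 0 by apply: contraNneq lt0 => c0; rewrite lg c0 scale0r /lead_term mcoeff0 scale0r.
  split=> //; have lI := has_leadZ c (@has_lead_compX I).
  have cI0 : c * lead_cst I != 0 by rewrite mulf_neq0 ?lead_cst_neq0.
  move: lg; rewrite (has_lead_term cI0 lI) /lead_term => /(congr1 (@msupp _ _)).
  rewrite !msuppMCX -?mcoeff_msupp ?lead_mon_mem //.
  by case.
have IM : grevlex_lt (lead_expo I) M by rewrite -lI.1; apply/bg/lead_mon_mem.
move=> /msuppD_le; rewrite mem_cat => /orP[|].
  by rewrite msuppMCX ?lI.2 // inE => /eqP->.
apply: IH; apply: belowD => //; apply/belowN/belowZ.
exact: has_lead_below (@has_lead_compX I) IM.
Qed.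

End Expressions.

(** * The generators *)

Section Generators.

Variables (p : nat) (F : fieldType) (c : 'M[F]_2).
Hypotheses (p_prime : prime p) (p_gt2 : (2 < p)%N) (charFp : p \in [pchar F]).

Local Notation x := (vx F).
Local Notation y := (vy F).
Local Notation z := (vz F).
Local Notation g12 := (gammabar p c 0 1).
Local Notation g13 := (gammabar p c 0 2).
Local Notation g23 := (gammabar p c 1 2).
Local Notation g14 := (gammabar p c 0 3).
Local Notation g24 := (gammabar p c 1 3).

(** With s and t for [trans_s c g] and [trans_t c g], the element [g] sends y to y + s x and delta
    to delta - t x^2. *)
Definition trans_s (g : 'Z_p * 'Z_p) : F := c 0 0 *+ g.1 + c 0 1 *+ g.2.
Definition trans_t (g : 'Z_p * 'Z_p) : F := c 1 0 *+ g.1 + c 1 1 *+ g.2.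

Lemma VM_act_shear f g : VM_act c f g = f \mPo shear (trans_s g) (trans_t g).
Proof. exact: VM_actE. Qed.

Lemma trans_sXp g : trans_s g ^+ p = c 0 0 ^+ p *+ g.1 + c 0 1 ^+ p *+ g.2.
Proof.
rewrite /trans_s -(pFrobenius_autE charFp) pFrobenius_autD_comm; last exact: mulrC.
by rewrite !pFrobenius_autMn !pFrobenius_autE.
Qed.

Lemma trans_tXp g : trans_t g ^+ p = c 1 0 ^+ p *+ g.1 + c 1 1 ^+ p *+ g.2.
Proof.
rewrite /trans_t -(pFrobenius_autE charFp) pFrobenius_autD_comm; last exact: mulrC.
by rewrite !pFrobenius_autMn !pFrobenius_autE.
Qed.

Lemma two_neq0 : (2 : F) != 0.
Proof. by rewrite -(dvdn_pcharf charFp) gtnNdvd. Qed.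

(** Cofactor expansion of a vanishing 3 by 3 determinant: (s, t, s^p) is a combination of the two
    columns of rows 0, 1, 2 of [gamma_rows], because integer multiples commute with Frobenius. *)
Lemma trans_f1 g : g12 * trans_s g ^+ p - g13 * trans_t g + g23 * trans_s g = 0.
Proof.
have [-> [-> [_ [-> _]]]] := gammabar_explicit p c.
by rewrite trans_sXp /trans_s /trans_t; ring.
Qed.

(** The same determinant with rows 0, 1, 3 and the column (s, t, t^p). *)
Lemma trans_f2 g : g12 * trans_t g ^+ p - g14 * trans_t g + g24 * trans_s g = 0.
Proof.
have [-> [_ [-> [_ ->]]]] := gammabar_explicit p c.
by rewrite trans_tXp /trans_s /trans_t; ring.
Qed.

Lemma Xp_add n (u v : {mpoly F[n]}) : (u + v) ^+ p = u ^+ p + v ^+ p.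
Proof.
have charP : p \in [pchar {mpoly F[n]}] by rewrite pchar_lalg.
by rewrite -!(pFrobenius_autE charP) pFrobenius_autD_comm //; apply: mulrC.
Qed.

Lemma shear_vx s t : x \mPo shear s t = x.
Proof. by rewrite comp_mpolyXU. Qed.

Lemma shear_vy s t : y \mPo shear s t = y + s *: x.
Proof. by rewrite comp_mpolyXU. Qed.

Lemma shear_vz s t :
  z \mPo shear s t = z + (2 * s) *: y + (s ^+ 2 + t) *: x.
Proof. by rewrite comp_mpolyXU. Qed.

Lemma shear_delta s t : delta F \mPo shear s t = delta F - t *: x ^+ 2.
Proof.
rewrite /delta comp_mpolyB rmorphXn rmorphM /= shear_vx shear_vy shear_vz.
by rewrite -!mul_mpolyC !(rmorphD, rmorphM, rmorphXn) /= ?rmorph_nat; ring.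
Qed.

Lemma in_invariants f :
  (forall g, f \mPo shear (trans_s g) (trans_t g) = f) -> f \in invariants p c.
Proof. by move=> inv_f; apply/forallP => g; rewrite VM_act_shear inv_f. Qed.

Lemma invariantsP f g : f \in invariants p c ->
  f \mPo shear (trans_s g) (trans_t g) = f.
Proof. by move=> /forallP/(_ g)/eqP; rewrite VM_act_shear. Qed.

Lemma vx_inv : x \in invariants p c.
Proof. by apply: in_invariants => g; rewrite shear_vx. Qed.

(** The shear changes [f1bar] by x^p times the left side of [trans_f1]. *)
Lemma f1bar_inv : f1bar p c \in invariants p c.
Proof.
apply: in_invariants => g; rewrite /f1bar !comp_mpolyD !comp_mpolyZ.
rewrite !(rmorphXn, rmorphM) /= shear_vx shear_vy shear_delta Xp_add exprZn.
have -> : x ^+ p = x ^+ 2 * x ^+ (p - 2) by rewrite -exprD subnKC // ltnW.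
have -> : x ^+ (p - 1) = x * x ^+ (p - 2) by rewrite -exprS -subSn // ltnW.
move: (trans_f1 g); move: (trans_s g) (trans_t g) => s t.
move/(congr1 (@mpolyC 3 F)).
rewrite mpolyC0 !(rmorphD, rmorphN, rmorphM) /= -!mul_mpolyC => E; apply/eqP; rewrite -subr_eq0; apply/eqP.
rewrite -[RHS](mul0r (x ^+ 2 * x ^+ (p - 2))) -E; ring.
Qed.

(** Since [f1bar] is invariant and p is odd, the numerator changes by [g12] x^(2p) times the left
    side of [trans_f2]. *)
Lemma f2bar_num_inv : f2bar_num p c \in invariants p c.
Proof.
apply: in_invariants => g; rewrite /f2bar_num !comp_mpolyD !comp_mpolyN !comp_mpolyZ.
rewrite !(rmorphXn, rmorphM) /= shear_vx shear_vy shear_delta.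
rewrite -[- (trans_t g *: _)]scaleNr (Xp_add (delta F)) exprZn (invariantsP g f1bar_inv).
have -> : x ^+ (2 * p - 2) = x ^+ p * x ^+ (p - 2) by rewrite -!exprD; congr (_ ^+ _); lia.
have -> : x ^+ (2 * p - 1) = x ^+ p * (x * x ^+ (p - 2)).
  by rewrite -exprS -!exprD; congr (_ ^+ _); lia.
rewrite -exprM mulnC exprM exprNn -signr_odd.
have -> : odd p by have := even_prime p_prime; case: odd; lia.
have -> : (x ^+ p) ^+ 2 = x ^+ p * (x ^+ 2 * x ^+ (p - 2)).
  by rewrite -exprD subnKC // ltnW.
move: (trans_f2 g); move: (trans_s g) (trans_t g) => s t.
move/(congr1 (@mpolyC 3 F)).
rewrite mpolyC0 !(rmorphD, rmorphN, rmorphM, rmorphXn) /= -!mul_mpolyC => E; apply/eqP; rewrite -subr_eq0; apply/eqP.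
rewrite -[RHS](mul0r (g12%:MP * x ^+ p * (x ^+ 2 * x ^+ (p - 2)))) -E.
rewrite !(rmorphD, rmorphN, rmorphM, rmorphXn) /=.
ring.
Qed.

Lemma vx_neq0 : x != 0.
Proof. by rewrite -msupp_eq0 msuppX. Qed.

Lemma f2bar_inv : f2bar p c \in invariants p c.
Proof.
apply: in_invariants => g; have /(invariantsP g) := f2bar_num_inv.
rewrite -f2barE // comp_mpolyZ rmorphM rmorphXn /= shear_vx.
move/(scalerI two_neq0)/mulfI; apply.
by rewrite expf_neq0 ?vx_neq0.
Qed.

(** The terms y^(2p) of [f1bar ^+ 2] and of delta^p have cancelled. What remains is y^p delta, which
    carries the lead term y^(p+2), plus a multiple of x. *)
Lemma f2bar_explicit : 2 *: f2bar p c =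
  (2 * (g12 * g13)) *: (y ^+ p * delta F) +
  x * (g12 ^+ 2 *: (x * z ^+ p) + (2 * (g12 * g23)) *: y ^+ p.+1 +
    x ^+ (p - 3) * (g13 *: delta F + g23 *: (y * x)) ^+ 2 +
    (g12 * g14) *: (delta F * x ^+ p.-1) + (g12 * g24) *: (y * x ^+ p)).
Proof.
have X0 : x ^+ (p - 2) != 0 by rewrite expf_neq0 ?vx_neq0.
apply: (mulfI X0); rewrite -scalerAr f2barE // /f2bar_num /f1bar.
have -> : delta F ^+ p = y ^+ p * y ^+ p - x ^+ p * z ^+ p.
  rewrite /delta Xp_add exprNn -signr_odd.
  have -> : odd p by have := even_prime p_prime; case: odd; lia.
  by rewrite expr2 !exprMn expr1 mulN1r.
have -> : x ^+ (2 * p - 2) = x ^+ 3 * x ^+ (p - 3) * x ^+ (p - 2).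
  by rewrite -!exprD; congr (_ ^+ _); lia.
have -> : x ^+ (2 * p - 1) = x ^+ 4 * x ^+ (p - 3) * x ^+ (p - 2).
  by rewrite -!exprD; congr (_ ^+ _); lia.
have -> : x ^+ p.-1 = x ^+ 2 * x ^+ (p - 3) by rewrite -exprD; congr (_ ^+ _); lia.
have -> : x ^+ p = x ^+ 3 * x ^+ (p - 3) by rewrite -exprD; congr (_ ^+ _); lia.
have -> : x ^+ (p - 1) = x ^+ 2 * x ^+ (p - 3) by rewrite -exprD; congr (_ ^+ _); lia.
have -> : x ^+ (p - 2) = x * x ^+ (p - 3) by rewrite -exprS; congr (_ ^+ _); lia.
rewrite [y ^+ p.+1]exprS -!mul_mpolyC !(rmorphM, rmorphXn, rmorph_nat) /=.
move: (g12%:MP) (g13%:MP) (g23%:MP) (g14%:MP) (g24%:MP) => a b e d h.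
move: (x ^+ (p - 3)) (y ^+ p) (z ^+ p) (delta F) => X Y Z D.
ring.
Qed.

End Generators.

(** * The orbit of z and its norm *)

Section Norm.

Variables (p : nat) (F : fieldType) (c : 'M[F]_2).
Hypotheses (p_prime : prime p) (p_gt2 : (2 < p)%N) (charFp : p \in [pchar F]).
Hypothesis (gamma13_neq0 : gammabar p c 0 2 != 0).

Local Notation x := (vx F).
Local Notation y := (vy F).
Local Notation z := (vz F).

Lemma natr_inj_Zp (i j : 'Z_p) : (i : nat)%:R = (j : nat)%:R :> F -> i = j.
Proof.
have p_gt1 := prime_gt1 p_prime.
wlog le_ij : i j / (i <= j)%N => [IH eij|eij].
  by have /orP[/IH->|/IH->] := leq_total i j.
apply/val_inj/eqP => /=; rewrite eqn_leq le_ij /= -subn_eq0.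
have : (p %| j - i)%N by rewrite (dvdn_pcharf charFp) natrB // eij subrr.
have ltj : (j < p)%N by rewrite -[X in (_ < X)%N](Zp_cast p_gt1).
by case: (j - i)%N (leq_ltn_trans (leq_subr i j) ltj) => // k lk; rewrite gtnNdvd.
Qed.

(** Both s and s^p are linear in the two coordinates of the group element, with determinant
    [gammabar p c 0 2]; Cramer's rule recovers the coordinates in F, hence modulo p. *)
Lemma trans_s_inj : injective (trans_s (p := p) c).
Proof.
move=> g h egh; have eghp : trans_s c g ^+ p = trans_s c h ^+ p by rewrite egh.
move: egh eghp; rewrite !trans_sXp // /trans_s.
have [_ [eD _]] := gammabar_explicit p c.
case: g h => [g1 g2] [h1 h2] /= e1 e2.
have det0 (u v : F) : c 0 0 * u + c 0 1 * v = 0 ->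
    c 0 0 ^+ p * u + c 0 1 ^+ p * v = 0 -> u = 0 /\ v = 0.
  move=> E1 E2; split; apply: (mulfI gamma13_neq0); rewrite mulr0 eD.
    transitivity (c 0 1 ^+ p * (c 0 0 * u + c 0 1 * v) -
      c 0 1 * (c 0 0 ^+ p * u + c 0 1 ^+ p * v)); last by rewrite E1 E2; ring.
    ring.
  transitivity (c 0 0 * (c 0 0 ^+ p * u + c 0 1 ^+ p * v) -
      c 0 0 ^+ p * (c 0 0 * u + c 0 1 * v)); last by rewrite E1 E2; ring.
  ring.
have [] := det0 ((g1 : nat)%:R - (h1 : nat)%:R) ((g2 : nat)%:R - (h2 : nat)%:R).
- apply/eqP; rewrite !mulrBr !mulr_natr addrACA -opprD subr_eq0; exact/eqP.
- apply/eqP; rewrite !mulrBr !mulr_natr addrACA -opprD subr_eq0; exact/eqP.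
by move=> /subr0_eq/natr_inj_Zp-> /subr0_eq/natr_inj_Zp->.
Qed.

Lemma VM_act_vz (g : 'Z_p * 'Z_p) : VM_act c z g =
  z + (2 * trans_s c g) *: y + (trans_s c g ^+ 2 + trans_t c g) *: x.
Proof. by rewrite VM_act_shear // shear_vz. Qed.

(** The coefficient of y in the image of z is 2 s. Hence the orbit has p^2 elements and [undup]
    discards nothing. *)
Lemma VM_act_vz_inj : injective (@VM_act F p c z).
Proof.
move=> g h; rewrite !VM_act_vz => /(congr1 (mcoeff U_(1))).
rewrite !mcoeffD !mcoeffZ !mcoeffXU /= !mulr1 !mulr0 !addr0 !add0r.
by move/(mulfI (two_neq0 p_gt2 charFp))/trans_s_inj.
Qed.

Lemma orbit_normE : orbit_norm p c z = \prod_(g : 'Z_p * 'Z_p) VM_act c z g.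
Proof.
rewrite /orbit_norm /act_orbit undup_id ?big_map ?big_enum //.
by rewrite map_inj_uniq ?enum_uniq //; apply: VM_act_vz_inj.
Qed.

Lemma orbit_norm_inv : orbit_norm p c z \in invariants p c.
Proof.
apply/forallP => h; apply/eqP; rewrite orbit_normE VM_actE // rmorph_prod /=.
rewrite [RHS](reindex_inj (addIr h)) /=; apply: eq_bigr => g _.
by rewrite VM_actD // [RHS]VM_actE.
Qed.

Lemma card_group : #|{: 'Z_p * 'Z_p}| = (p * p)%N.
Proof. by rewrite card_prod card_ord Zp_cast // prime_gt1. Qed.

End Norm.

(** * Lead terms of the four generators *)

Section Leads.

Variables (p : nat) (F : fieldType) (c : 'M[F]_2).
Hypothesis p_gt2 : (2 < p)%N.

Local Notation x := (vx F).
Local Notation y := (vy F).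
Local Notation z := (vz F).
Local Notation g12 := (gammabar p c 0 1).
Local Notation g13 := (gammabar p c 0 2).

(** The exponent of the smallest variable x is compared first; this makes multiples of x negligible
    against monomials of equal degree free of x. *)
Lemma grevlex_lt_x0 (m m' : 'X_{1..3}) :
  mdeg m = mdeg m' -> m' 0 = 0%N -> m 0 != 0%N -> grevlex_lt m m'.
Proof.
move=> dm m'0 m0; rewrite /grevlex_lt dm eqxx; apply/orP; right.
by apply/existsP; exists 0; rewrite m'0 lt0n m0; apply/forallP.
Qed.

Lemma below_vxM f m a m' : has_lead f m a ->
  (mdeg m).+1 = mdeg m' -> m' 0 = 0%N -> below m' (x * f).
Proof.
move=> lf dm m'0; apply: has_lead_below (has_leadM (has_leadX U_(0)) lf) _.
by apply: grevlex_lt_x0 => //; rewrite ?mdegD ?mdeg1 // mnmDE mnm1E.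
Qed.

Lemma has_lead_delta : has_lead (delta F) (U_(1) *+ 2)%MM 1.
Proof.
apply: has_leadDl; first exact: has_lead_mpolyXn.
apply/belowN/(below_vxM (has_leadX U_(2))); first by rewrite mdegMn !mdeg1.
by rewrite mulmnE mnm1E.
Qed.

Ltac mdeg_lia := rewrite ?(mdegD, mdegMn, mdeg1); lia.

Lemma has_lead_f1bar : has_lead (f1bar p c) (U_(1) *+ p)%MM g12.
Proof.
have X k : has_lead (x ^+ k) (U_(0%R) *+ k)%MM 1.
  exact: has_lead_mpolyXn.
have m0 : (U_(1) *+ p : 'X_{1..3})%MM 0 = 0%N by rewrite mulmnE mnm1E.
rewrite /f1bar; apply: has_leadDl; first apply: has_leadDl.
- have := has_leadZ g12 (has_leadXn p (has_leadX U_(1))).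
  by rewrite expr1n mulr1.
- have -> : x ^+ (p - 2) = x * x ^+ (p - 3) by rewrite -exprS; congr (_ ^+ _); lia.
  rewrite mulrCA; apply/belowZ/(below_vxM (has_leadM has_lead_delta (X _))) => //.
  by mdeg_lia.
have -> : x ^+ (p - 1) = x * x ^+ (p - 2) by rewrite -exprS; congr (_ ^+ _); lia.
rewrite mulrCA; apply/belowZ/(below_vxM (has_leadM (has_leadX U_(1)) (X _))) => //.
by mdeg_lia.
Qed.

Hypotheses (p_prime : prime p) (charFp : p \in [pchar F]).

Lemma has_lead_f2bar : has_lead (f2bar p c) (U_(1) *+ p.+2)%MM (g12 * g13).
Proof.
have two0 := two_neq0 p_gt2 charFp.
have X i k : has_lead ('X_i ^+ k : {mpoly F[3]}) (U_(i) *+ k)%MM 1.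
  exact: has_lead_mpolyXn.
have lD := has_lead_delta.
have m0 : (U_(1) *+ p.+2 : 'X_{1..3})%MM 0 = 0%N by rewrite mulmnE mnm1E.
rewrite -[f2bar p c](scalerK two0) -[g12 * g13](mulKf two0); apply: has_leadZ.
rewrite (f2bar_explicit c p_prime p_gt2 charFp); apply: has_leadDl.
  have := has_leadZ (2 * (g12 * g13)) (has_leadM (X 1 p) lD).
  by rewrite !mulr1; congr has_lead; apply/mnmP => i; rewrite mnmDE !mulmnE; lia.
rewrite !mulrDr -!scalerAr; do 4?[apply: belowD]; try apply: belowZ.
- apply: (below_vxM (has_leadM (has_leadX U_(0)) (X 2 p))) => //; mdeg_lia.
- apply: (below_vxM (X 1 p.+1)) => //; mdeg_lia.
- set q : {mpoly F[3]} := g13 *: _ + _; have lq : has_lead q (U_(1) *+ 2)%MM (g13 * 1).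
    apply: has_leadDl; first exact: has_leadZ.
    rewrite mulrC; apply/belowZ/(below_vxM (has_leadX U_(1))); first mdeg_lia.
    by rewrite mulmnE mnm1E.
  apply: (below_vxM (has_leadM (X 0 (p - 3)%N) (has_leadXn 2 lq))) => //; mdeg_lia.
- apply: (below_vxM (has_leadM lD (X 0 p.-1))) => //; mdeg_lia.
- apply: (below_vxM (has_leadM (has_leadX U_(1)) (X 0 p))) => //; mdeg_lia.
Qed.

Hypothesis gamma13_neq0 : gammabar p c 0 2 != 0.

Lemma has_lead_norm : has_lead (orbit_norm p c z) (U_(2) *+ (p * p))%MM 1.
Proof.
rewrite orbit_normE // -(card_group p_prime) cardT -[index_enum _]enumT.
apply: has_lead_prod => g; rewrite VM_act_vz //.
have L (i : 'I_3) : has_lead 'X_i U_(i)%MM (1 : F) by apply: has_leadX.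
do 2?[apply: has_leadDl; last apply/belowZ/(has_lead_below (L _))]; first exact: L.
  rewrite /grevlex_lt !mdeg1 /=; apply/existsP; exists 1; rewrite !mnm1E /=.
  by apply/forallP => -[[|[|[|]]] lti] //; rewrite !mnm1E.
by apply: grevlex_lt_x0; rewrite ?mdeg1 ?mnm1E.
Qed.

End Leads.

(** * Normal forms *)

Section BoundedExponent.

Variables (F : fieldType) (k : nat) (i : 'I_k).
Implicit Types (m : 'X_{1..k}) (P Q : {mpoly F[k]}).

(** For the variable T_2 and d = p these are the normal forms; d = 1 says that the variable is
    absent. *)
Definition bounded d P := forall m, m \in msupp P -> (m i < d)%N.

Lemma bounded0 d : bounded d 0.
Proof. by move=> m; rewrite msupp0. Qed.

Lemma boundedW d d' P : (d <= d')%N -> bounded d P -> bounded d' P.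
Proof. by move=> le_d bP m /bP /leq_trans; apply. Qed.

Lemma boundedD d P Q : bounded d P -> bounded d Q -> bounded d (P + Q).
Proof. by move=> bP bQ m /msuppD_le; rewrite mem_cat => /orP[/bP|/bQ]. Qed.

Lemma boundedZ d (a : F) P : bounded d P -> bounded d (a *: P).
Proof. by move=> bP m /msuppZ_le /bP. Qed.

Lemma boundedX d m : (m i < d)%N -> bounded d 'X_[m].
Proof. by move=> lm m'; rewrite msuppX inE => /eqP->. Qed.

Lemma bounded_sum (I : Type) (r : seq I) (A : pred I) (G : I -> {mpoly F[k]}) d :
  (forall j, A j -> bounded d (G j)) -> bounded d (\sum_(j <- r | A j) G j).
Proof.
by move=> bG; elim/big_rec: _ => [|j P Aj bP]; [apply: bounded0|apply/boundedD/bP/bG].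
Qed.

Lemma boundedXM d m P : bounded d P -> bounded (m i + d) ('X_[m] * P).
Proof.
move=> bP m'; rewrite mulrC (perm_mem (msuppMX _ _)) => /mapP[m2 /bP l2 ->].
by rewrite mnmDE ltn_add2l.
Qed.

Lemma boundedXnM d K j P : j != i -> bounded d P -> bounded d ('X_j ^+ K * P).
Proof.
by move=> ne /(boundedXM (m := (U_(j) *+ K)%MM)); rewrite mulmnE mnm1E (negPf ne) mpolyXn.
Qed.

Lemma boundedUM d P : bounded d P -> bounded d.+1 ('X_i * P).
Proof. by move=> /(boundedXM (m := U_(i)%MM)); rewrite mnm1E eqxx. Qed.

(** The constant lead coefficient lets ['X_i ^+ d] be traded for a multiple of [N], of smaller
    degree in that variable. The induction is on the excess [n] of the exponent bound over [d]. *)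
Lemma bounded_div d (a : F) N P : a != 0 -> bounded d N ->
  exists S P', [/\ P = S * (a *: 'X_i ^+ d + N) + P' & bounded d P'].
Proof.
move=> a0 bN; set R := _ + N.
pose good P := exists S P', [/\ P = S * R + P' & bounded d P'].
have goodD P1 P2 : good P1 -> good P2 -> good (P1 + P2).
  move=> [S1 [P1' [-> b1]]] [S2 [P2' [-> b2]]].
  by exists (S1 + S2), (P1' + P2'); split; [ring|apply: boundedD].
have goodZ u P1 : good P1 -> good (u *: P1).
  move=> [S1 [P1' [-> b1]]]; exists (u *: S1), (u *: P1').
  by split; [rewrite scalerDr scalerAl|apply: boundedZ].
suff {P} H n P : bounded (d + n) P -> good P.
  apply: (H (msize P) P) => m /msize_mdeg_lt lm.
  by rewrite ltn_addl // (leq_ltn_trans _ lm) // mdegE (bigD1 i) //= leq_addr.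
elim: n P => [|n IHn] P bP.
  by rewrite addn0 in bP; exists 0, P; rewrite mul0r add0r.
rewrite [P]mpolyE big_seq_cond; elim/big_rec: _ => [|m Q /andP[mP _] goodQ].
  by exists 0, 0; rewrite mul0r add0r; split=> //; apply: bounded0.
apply: goodD goodQ; apply: (goodZ).
have := bP _ mP; rewrite addnS ltnS leq_eqVlt => /orP[/eqP mi|mi]; last first.
  exact/IHn/boundedX.
pose m' := (m - U_(i) *+ d)%MM.
have em : m = (m' + U_(i) *+ d)%MM.
  rewrite submK //; apply/mnm_lepP => j; rewrite mulmnE mnm1E.
  by case: eqP => [<-|_]; rewrite ?mul0n // mul1n mi leq_addr.
have m'i : m' i = n by rewrite /m' mnmBE mulmnE mnm1E eqxx mul1n mi addKn.
(* Since [m' i] is [n], trading ['X_i ^+ d] for [N] leaves exponents strictly below [d + n]. *)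
have [S [P' [eS bP']]] : good (- a^-1 *: ('X_[m'] * N)).
  apply: (goodZ); apply: IHn; rewrite addnC -m'i; exact: boundedXM.
exists (a^-1 *: 'X_[m'] + S), P'; split=> //.
rewrite mulrDl -addrA -eS em mpolyXD /R mpolyXn mulrDr -!scalerAr -!scalerAl.
by rewrite scalerA mulfV // scale1r scaleNr addrK.
Qed.

End BoundedExponent.

(** * Exponents of products of the lead monomials *)

Section BasisExponents.

Variable p : nat.

Local Notation i0 := (0%R : 'I_4).
Local Notation i1 := (1%R : 'I_4).
Local Notation i2 := (2%R : 'I_4).
Local Notation i3 := (3%R : 'I_4).

Definition basis_expo (i : 'I_4) : 'X_{1..3} :=
  tnth [tuple U_(0%R); U_(1%R) *+ p; U_(1%R) *+ p.+2; U_(2%R) *+ (p * p)]%MM i.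

Local Notation expo := (lead_expo basis_expo).

Lemma lead_expoE m :
  (expo m 0%R = m i0) * (expo m 1%R = (m i1 * p + m i2 * p.+2)%N) *
  (expo m 2%R = (m i3 * (p * p))%N).
Proof.
have o2 : lift ord0 (lift ord0 ord0) = i2 by apply: val_inj.
have o1 : lift ord0 ord0 = i1 by apply: val_inj.
have o3 : lift ord0 (lift ord0 (lift ord0 ord0)) = i3 by apply: val_inj.
rewrite /lead_expo !big_ord_recl big_ord0 o3 o2 o1 /basis_expo.
rewrite !(tnth_nth 0%MM) /= !mnmDE !mulmnE !mnmE.
by do !split; rewrite /= ?addn0 ?muln0 ?mul0n ?add0n ?addn0 ?mul1n //; lia.
Qed.

Hypotheses (p_prime : prime p) (p_gt2 : (2 < p)%N).

(** The exponents of x and z determine [m i0] and [m i3]. That of y is (m1 + m2) p + 2 m2, which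
    determines m1 and m2 as long as m2 < p, because p is odd. *)
Lemma lead_expo_inj (m m' : 'X_{1..4}) : (m i2 < p)%N -> (m' i2 < p)%N ->
  expo m = expo m' -> m = m'.
Proof.
move=> m2 m'2 E; have odd_p : odd p by have := even_prime p_prime; case: odd; lia.
have e0 : expo m 0 = expo m' 0 by rewrite E.
have e1 : expo m 1%R = expo m' 1 by rewrite E.
have e2 : expo m 2%R = expo m' 2 by rewrite E.
move: e0 e1 e2; rewrite !lead_expoE => e0 e1 /eqP; rewrite eqn_pmul2r; last by lia.
move/eqP => e3.
have e2 : m i2 = m' i2.
  (* If s = u + 1, parity fails as p is odd; otherwise s >= u + 2, which forces v >= p. *)
  have aux u v s t : (u * p + v.*2 = s * p + t.*2 -> u < s -> v < p -> False)%N.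
    move=> E' us vp; have [esu|ltu] := eqVneq s u.+1.
      by move/(congr1 odd): E'; rewrite esu !oddD !oddM !odd_double odd_p /=; case: odd.
    have : (u.+2 * p <= s * p)%N by rewrite leq_mul2r; apply/orP; right; lia.
    by rewrite mulSn mulSn; lia.
  have E1 : ((m i1 + m i2) * p + (m i2).*2 =
            (m' i1 + m' i2) * p + (m' i2).*2)%N by lia.
  have [/(aux _ _ _ _ E1)|/(aux _ _ _ _ (esym E1))|eqs] :=
    ltngtP (m i1 + m i2)%N (m' i1 + m' i2)%N.
  - by move/(_ m2).
  - by move/(_ m'2).
  by rewrite eqs in E1; lia.
rewrite e2 in e1.
have e1' : m i1 = m' i1 by apply/eqP; rewrite -(eqn_pmul2r (ltnW (ltnW p_gt2))); lia.
apply/mnmP => -[[|[|[|[|//]]]] lti].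
- by move: e0; congr (m _ = m' _); apply: val_inj.
- by move: e1'; congr (m _ = m' _); apply: val_inj.
- by move: e2; congr (m _ = m' _); apply: val_inj.
by move: e3; congr (m _ = m' _); apply: val_inj.
Qed.

Lemma bounded_expo_inj (F : fieldType) (P : {mpoly F[4]}) : bounded i2 p P -> {in msupp P &, injective expo}.
Proof. by move=> bP m m' /bP m2 /bP m'2; apply: lead_expo_inj. Qed.

End BasisExponents.

(** * Normal forms and cancellation of x *)

Section NormalForms.

Variables (p : nat) (F : fieldType) (c : 'M[F]_2).
Hypotheses (p_prime : prime p) (p_gt2 : (2 < p)%N) (charFp : p \in [pchar F]).
Hypotheses (gamma12_neq0 : gammabar p c 0 1 != 0)
           (gamma13_neq0 : gammabar p c 0 2 != 0).

Local Notation x := (vx F).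
Local Notation g12 := (gammabar p c 0 1).
Local Notation g13 := (gammabar p c 0 2).
Local Notation b := (basisV p c).
Local Notation i0 := (0%R : 'I_4).
Local Notation i1 := (1%R : 'I_4).
Local Notation i2 := (2%R : 'I_4).
Local Notation i3 := (3%R : 'I_4).

Definition basis_cst (i : 'I_4) : F := tnth [tuple 1; g12; g12 * g13; 1] i.

Lemma has_lead_basis i : has_lead (tnth b i) (basis_expo p i) (basis_cst i).
Proof.
rewrite /basis_expo /basis_cst (tnth_nth 0) (tnth_nth 0%MM) (tnth_nth 0 _ i).
case: i => [[|[|[|[|//]]]] lti] /=.
- exact: has_leadX.
- exact: has_lead_f1bar.
- exact: has_lead_f2bar.
- exact: has_lead_norm.
Qed.

Lemma basis_cst_neq0 i : basis_cst i != 0.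
Proof.
rewrite /basis_cst (tnth_nth 0).
by case: i => [[|[|[|[|//]]]] lti] /=; rewrite ?oner_neq0 ?mulf_neq0.
Qed.

Local Notation expo := (lead_expo (basis_expo p)).

Lemma normal_vx_div (f : {mpoly F[3]}) P :
  bounded i2 p P -> x * f = P \mPo b -> exists2 Q, bounded i2 p Q & f = Q \mPo b.
Proof.
move=> bP xf.
pose P0 := \sum_(m <- msupp P | m i0 == 0%N) P@_m *: 'X_[m].
pose Q := \sum_(m <- msupp P | m i0 != 0%N) P@_m *: 'X_[(m - U_(i0))%MM].
have eP : P = P0 + 'X_[U_(i0)] * Q.
  rewrite [LHS]mpolyE (bigID (fun m : 'X_{1..4} => m i0 == 0%N)) /=; congr (_ + _).
  rewrite mulr_sumr; apply: eq_bigr => m m0; rewrite -scalerAr -mpolyXD.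
  by rewrite addmC submK //; apply/mnm_lepP => j; rewrite mnm1E; case: eqP => // <-; rewrite lt0n.
have bP0 : bounded i2 p P0.
  by rewrite /P0 big_seq_cond; apply: bounded_sum => m /andP[mP _]; apply/boundedZ/boundedX/bP.
have bQ : bounded i2 p Q.
  rewrite /Q big_seq_cond; apply: bounded_sum => m /andP[mP _]; apply/boundedZ/boundedX.
  by apply: leq_ltn_trans (bP m mP); rewrite mnmBE leq_subr.
have e0 : P0 \mPo b = x * (f - (Q \mPo b)).
  by rewrite mulrBr xf {1}eP comp_mpolyD rmorphM /= comp_mpolyXU addrK.
have P00 : P0 = 0.
  apply/eqP; apply: contraT => P0n.
  have [m mP0 lP0] := has_lead_comp has_lead_basis P0n (bounded_expo_inj p_prime p_gt2 bP0).
  have := has_lead_coef lP0.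
  (* By [e0] every monomial is divisible by x, whereas the x-exponent of [expo m] is [m i0], which
     is 0 on the support of [P0]. *)
  have -> : (P0 \mPo b)@_(expo m) = 0.
    apply: memN_msupp_eq0; rewrite e0 mulrC (perm_mem (msuppMX _ _)).
    apply/negP => /mapP[m' _ /(congr1 (fun k : 'X_{1..3} => k 0))].
    rewrite lead_expoE mnmDE mnm1E eqxx add1n.
    suff -> : m i0 = 0%N by [].
    apply/eqP; move: mP0; rewrite /P0.
    apply: contraLR => m0; rewrite -mcoeff_eq0 raddf_sum /= big1 // => m2 m20.
    rewrite mcoeffZ mcoeffX; case: eqP => [em|_]; last by rewrite mulr0.
    by rewrite em (negPf m0) in m20.
  move/esym/eqP; rewrite mulf_eq0 (negPf (lead_cst_neq0 basis_cst_neq0 _)) orbF.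
  by rewrite -[_ == 0]negbK -mcoeff_msupp mP0.
exists Q => //; apply/subr0_eq/(mulfI (vx_neq0 F)).
by rewrite -e0 P00 comp_mpoly0 mulr0.
Qed.

Lemma normal_vxX_div K (f : {mpoly F[3]}) P :
  bounded i2 p P -> x ^+ K * f = P \mPo b ->
  exists2 Q, bounded i2 p Q & f = Q \mPo b.
Proof.
elim: K P => [|K IHK] P bP; first by rewrite expr0 mul1r => ->; exists P.
rewrite exprS -mulrA => /(normal_vx_div bP)[Q bQ]; exact: IHK.
Qed.

(** Division by T_2^p - N, which vanishes on the generators and has lead coefficient 1 in T_2. *)
Lemma normal_reduce N P : bounded i2 p N -> f2bar p c ^+ p = N \mPo b ->
  exists2 Q, bounded i2 p Q & P \mPo b = Q \mPo b.
Proof.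
move=> bN eN; have bN' : bounded i2 p (- N) by rewrite -scaleN1r; apply: boundedZ.
have [S [Q [-> bQ]]] := bounded_div P (oner_neq0 F) bN'.
exists Q => //; rewrite comp_mpolyD rmorphM /= comp_mpolyB comp_mpolyZ rmorphXn /=.
by rewrite comp_mpolyXU /= eN scale1r subrr mulr0 add0r.
Qed.

End NormalForms.

(** * Linearization of the action *)

(** Uniqueness of division by the monic [D] makes quotient and remainder invariant too. The
    remainder is constant by a root count, and induction applies to the quotient. *)
Lemma shift_invariant_comp (R : idomainType) (D g : {poly R}) (r : seq R) :
  D \is monic -> uniq r -> (0 < size r)%N -> size D = (size r).+1 ->
  (forall s, s \in r -> D \Po ('X + s%:P) = D) ->
  (forall s, s \in r -> g \Po ('X + s%:P) = g) ->
  exists q, g = q \Po D.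
Proof.
move=> monD uniq_r r_gt0 szD invD.
have [n] := ubnP (size g); elim: n g => // n IHn g szg invg.
have eg := Pdiv.RingMonic.rdivp_eq monD g.
set q := Pdiv.Ring.rdivp g D in eg; set t := Pdiv.Ring.rmodp g D in eg.
have szt : (size t < size D)%N by rewrite Pdiv.Ring.ltn_rmodp monic_neq0.
have inv s : s \in r -> q \Po ('X + s%:P) = q /\ t \Po ('X + s%:P) = t.
  move=> sr; have := invg s sr; rewrite {1}eg comp_polyD comp_polyM invD // => e1.
  have szt' : (size (t \Po ('X + s%:P)) < size D)%N.
    by rewrite size_comp_poly2 // size_XaddC.
  split.
    rewrite -[LHS](Pdiv.RingMonic.rdivp_addl_mul_small monD _ szt') e1.
    by rewrite /q.
  rewrite -[LHS](Pdiv.RingMonic.rmodp_addl_mul_small monD (q \Po ('X + s%:P)) szt').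
  by rewrite e1.
(* Invariance gives t(s) = t(0) for every s in [r], which is more roots of t - t(0) than its degree
   allows. *)
have et : t = (t.[0])%:P.
  apply/eqP; rewrite -subr_eq0; apply: contraT => ne.
  have : all (root (t - (t.[0])%:P)) r.
    apply/allP => s sr; rewrite rootE !hornerE subr_eq0.
    by rewrite -[t in t.[0]](inv s sr).2 horner_comp !hornerE.
  move/(max_poly_roots ne)/(_ uniq_r); rewrite ltnNge => /negP[].
  rewrite (leq_trans (size_polyD _ _)) // geq_max size_polyN.
  by rewrite (leq_trans (size_polyC_leq1 _)) // andbT -ltnS -szD.
have [q' eq'] : exists q', q = q' \Po D.
  have [->|q0] := eqVneq q 0; first by exists 0; rewrite comp_poly0.
  apply: IHn => [|s /inv[]//]; rewrite -ltnS (leq_trans _ szg) // ltnS.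
  have D0 := monic_neq0 monD.
  have szqD : size (q * D) = (size q + size r)%N.
    by rewrite size_mul // szD addnS.
  have -> : size g = (size q + size r)%N.
    rewrite eg size_polyDl szqD // et (leq_ltn_trans (size_polyC_leq1 _)) //.
    by move: q0; rewrite -size_poly_gt0; lia.
  by rewrite -[X in (X < _)%N]addn0 ltn_add2l.
by exists (q' * 'X + (t.[0])%:P); rewrite comp_poly_MXaddC -eq' -et.
Qed.

Lemma mpoly_rmorph_ext (F : fieldType) n (S : comNzRingType)
    (f g : {rmorphism {mpoly F[n]} -> S}) :
  (forall a, f a%:MP = g a%:MP) -> (forall i, f 'X_i = g 'X_i) -> f =1 g.
Proof.
move=> eC eX P; rewrite [P]mpolyE !rmorph_sum; apply: eq_bigr => m _ /=.
rewrite -mul_mpolyC !rmorphM eC mpolyXE_id !rmorph_prod /=; congr (_ * _).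
by apply: eq_bigr => i _; rewrite !rmorphXn /= eX.
Qed.

Lemma size_lead_CXnD (S : idomainType) (a : S) n (q : {poly S}) :
  a != 0 -> (size q <= n)%N ->
  size (a%:P * 'X^n + q) = n.+1 /\ lead_coef (a%:P * 'X^n + q) = a.
Proof.
move=> a0 szq; have szX : size (a%:P * 'X^n) = n.+1 by rewrite size_Cmul // size_polyXn.
split; first by rewrite size_polyDl szX.
by rewrite lead_coefDl ?szX // lead_coefM lead_coefC lead_coefXn mulr1.
Qed.

Lemma mpolyC_neq0 (F : fieldType) n (a : F) : a != 0 -> (a%:MP : {mpoly F[n]}) != 0.
Proof. by rewrite mpolyC_eq0. Qed.

(* Solves for C^p, with X, C, N in the roles of x, f2 / x^(p+2), N_G(z) / x^(p^2). *)
Lemma exp_relation (S : comNzRingType) (p : nat) (X C T N M k k' : S) (K : nat) :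
  k' * k = 1 -> N = k * C ^+ p + T -> X ^+ K * T = M ->
  X ^+ (K + p * p) * (X ^+ p.+2 * C) ^+ p =
  k' * (X ^+ (K + p * p.+2) * (X ^+ (p * p) * N) - X ^+ (p * p + p * p.+2) * M).
Proof.
move=> kk -> <-; rewrite exprMn -exprM [(p.+2 * p)%N]mulnC !exprD.
move: (X ^+ K) (X ^+ (p * p)) (X ^+ (p * p.+2)) (C ^+ p) => u v w Cp.
by transitivity (k' * k * (u * v * (w * Cp))); [rewrite kk mul1r | ring].
Qed.

Section Linearization.

Variables (p : nat) (F : fieldType) (c : 'M[F]_2).
Hypotheses (p_prime : prime p) (p_gt2 : (2 < p)%N) (charFp : p \in [pchar F]).
Hypotheses (gamma12_neq0 : gammabar p c 0 1 != 0)
           (gamma13_neq0 : gammabar p c 0 2 != 0).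

Local Notation x := (vx F).
Local Notation y := (vy F).
Local Notation z := (vz F).
Local Notation g12 := (gammabar p c 0 1).
Local Notation g13 := (gammabar p c 0 2).
Local Notation g23 := (gammabar p c 1 2).
Local Notation g14 := (gammabar p c 0 3).
Local Notation g24 := (gammabar p c 1 3).
Local Notation R := {mpoly F[2]}.
Local Notation cst a := ((@mpolyC 2 F a)%:P).
Local Notation X := (('X_0 : R)%:P).
Local Notation A := (('X_1 : R)%:P).

(* R is F[x, A] with A = f1 / x^p, and the variable 'X of {poly R} is u = y / x;
   lin_delta, lin_z, lin_f2 and lin_norm are delta / x^2, z / x, f2 / x^(p+2) and
   N_G(z) / x^(p^2). *)
Definition lin_delta : {poly R} :=
  cst g13^-1 * (A - cst g12 * 'X ^+ p - cst g23 * 'X).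

Definition lin_z : {poly R} := 'X ^+ 2 - lin_delta.

(** The substitution y = x u, z = x (u^2 - w), taken with values in a polynomial ring so that no
    denominators occur. *)
Definition lin_map : {mpoly F[3]} -> {poly R} :=
  mmap (polyC \o @mpolyC 2 F) (tnth [tuple X; X * 'X; X * lin_z]).

HB.instance Definition _ := GRing.RMorphism.on lin_map.

Lemma lin_mapC a : lin_map a%:MP = cst a.
Proof. exact: mmapC. Qed.

Lemma lin_mapZ a f : lin_map (a *: f) = cst a * lin_map f.
Proof. exact: mmapZ. Qed.

Lemma lin_map_var :
  (lin_map x = X) * (lin_map y = X * 'X) * (lin_map z = X * lin_z).
Proof.
have E (i : 'I_3) : lin_map 'X_i = tnth [tuple X; X * 'X; X * lin_z] i.
  by rewrite [LHS]mmapX mmap1U.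
by rewrite /vx /vy /vz !E !(tnth_nth 0).
Qed.

(* Only a one-sided partial inverse of lin_map, used for injectivity: it sends u
   to y instead of y / x, so that no fractions are needed. *)
Definition unlin_map : {poly R} -> {mpoly F[3]} :=
  horner_eval y \o map_poly (comp_mpoly
    [tuple x; g12 *: y ^+ p + g13 *: (y ^+ 2 - z) + g23 *: y]).

HB.instance Definition _ := GRing.RMorphism.on unlin_map.

Lemma unlin_mapX : unlin_map 'X = y.
Proof. by rewrite /unlin_map /= /horner_eval map_polyX hornerX. Qed.

Lemma unlin_mapC r : unlin_map r%:P =
  r \mPo [tuple x; g12 *: y ^+ p + g13 *: (y ^+ 2 - z) + g23 *: y].
Proof. by rewrite /unlin_map /= /horner_eval map_polyC hornerC. Qed.

Lemma unlin_map_cst a : unlin_map (cst a) = a%:MP.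
Proof. by rewrite unlin_mapC comp_mpolyC. Qed.

(** The image of [A] is chosen so that [lin_delta] goes to y^2 - z and [lin_z] to z; the composite
    is then a substitution by monomials. *)
Lemma unlin_lin_map f : unlin_map (lin_map f) = f \mPo [tuple x; x * y; x * z].
Proof.
apply: (mpoly_rmorph_ext (f := unlin_map \o lin_map)
  (g := comp_mpoly [tuple x; x * y; x * z])) => [a|i] /=.
  by rewrite lin_mapC unlin_map_cst comp_mpolyC.
have uX : unlin_map X = x by rewrite unlin_mapC comp_mpolyXU.
have uA : unlin_map A = g12 *: y ^+ p + g13 *: (y ^+ 2 - z) + g23 *: y.
  by rewrite unlin_mapC comp_mpolyXU.
have uz : unlin_map lin_z = z.
  rewrite /lin_z /lin_delta !(rmorphB, rmorphM, rmorphXn) /= uA !unlin_map_cst unlin_mapX.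
  rewrite -!mul_mpolyC.
  have : g13^-1%:MP * g13%:MP = 1 :> {mpoly F[3]} by rewrite -rmorphM /= mulVf.
  move: (g13^-1%:MP) (g13%:MP) => u v E.
  by transitivity (y ^+ 2 - u * v * (y ^+ 2 - z)); [ring|rewrite E mul1r subKr].
case: i => [[|[|[|//]]] lti].
- have -> : Ordinal lti = 0 by apply: val_inj.
  by rewrite -/(vx F) lin_map_var uX comp_mpolyXU.
- have -> : Ordinal lti = 1 by apply: val_inj.
  by rewrite -/(vy F) lin_map_var rmorphM /= uX unlin_mapX comp_mpolyXU.
have -> : Ordinal lti = 2 by apply: val_inj.
by rewrite -/(vz F) lin_map_var rmorphM /= uX uz comp_mpolyXU.
Qed.

(** The substitution of x, x y, x z maps distinct monomials to distinct ones, since it keeps the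
    exponents of y and z. *)
Lemma lin_map_inj : injective lin_map.
Proof.
suff inj0 f : f \mPo [tuple x; x * y; x * z] = 0 -> f = 0.
  move=> f g Efg; apply/subr0_eq/inj0.
  by rewrite comp_mpolyB -(unlin_lin_map f) -(unlin_lin_map g) Efg subrr.
pose h (m : 'X_{1..3}) : 'X_{1..3} := (m + U_(0%R) *+ (m 1%R + m 2%R))%MM.
have hX m : 'X_[m] \mPo [tuple x; x * y; x * z] = 'X_[h m].
  rewrite comp_mpolyX !big_ord_recl big_ord0 !(tnth_nth 0) /= mulr1 /h.
  rewrite mpolyXD mpolyXE_id -mpolyXn !big_ord_recl big_ord0 mulr1.
  rewrite -/(vx F).
  have -> : lift ord0 ord0 = 1 :> 'I_3 by apply: val_inj.
  have -> : lift ord0 (lift ord0 ord0) = 2 :> 'I_3 by apply: val_inj.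
  by rewrite -/(vy F) -/(vz F) !exprMn exprD; ring.
have h_inj : injective h.
  move=> m m' E; have e1 : m 1 = m' 1.
    by have := congr1 (fun k : 'X_{1..3} => k 1) E; rewrite !mnmDE !mulmnE !mnm1E !addn0.
  have e2 : m 2 = m' 2.
    by have := congr1 (fun k : 'X_{1..3} => k 2) E; rewrite !mnmDE !mulmnE !mnm1E !addn0.
  apply/(@addIm _ (U_(0%R) *+ (m 1%R + m 2%R)))%MM.
  by move: E; rewrite /h e1 e2.
move=> f0; apply/mpolyP => m; rewrite mcoeff0.
have := congr1 (mcoeff (h m)) f0; rewrite mcoeff0 comp_mpolyEX raddf_sum /= => <-.
rewrite [in LHS](mpolyE f) raddf_sum /=; apply: eq_bigr => m' _.
by rewrite !mcoeffZ hX !mcoeffX (inj_eq h_inj).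
Qed.

Lemma lin_deltaE : A = cst g12 * 'X ^+ p + cst g13 * lin_delta + cst g23 * 'X.
Proof.
have E : cst g13 * cst g13^-1 = 1 :> {poly R} by rewrite -!rmorphM /= mulfV.
by rewrite /lin_delta mulrA E; ring.
Qed.

Lemma lin_map_delta : lin_map (delta F) = X ^+ 2 * lin_delta.
Proof.
by rewrite /delta rmorphB rmorphXn rmorphM /= !lin_map_var /lin_z; move: X lin_delta => X0 w; ring.
Qed.

Lemma lin_map_f1 : lin_map (f1bar p c) = X ^+ p * A.
Proof.
rewrite /f1bar !rmorphD /= !lin_mapZ !(rmorphXn, rmorphM) /= !lin_map_var lin_map_delta.
rewrite lin_deltaE exprMn.
have -> : X ^+ p = X ^+ 2 * X ^+ (p - 2) by rewrite -exprD subnKC // ltnW.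
have -> : X ^+ (p - 1) = X * X ^+ (p - 2) by rewrite -exprS -subSn // ltnW.
by move: (X ^+ (p - 2)) ('X ^+ p) => Xp up; ring.
Qed.

(** The factor [X ^+ (p - 2)] is the one divided out in the definition of [f2bar]; the factor
    [X ^+ p.+2] accounts for the degree of [f2bar]. *)
Lemma f2bar_num_factor (S : comNzRingType) (X A w u a d h : S) :
  (X ^+ p * A) ^+ 2 - a ^+ 2 * (X ^+ 2 * w) ^+ p +
    a * d * (X ^+ 2 * w * X ^+ (2 * p - 2)) + a * h * (X * u * X ^+ (2 * p - 1)) =
  X ^+ (p - 2) * (X ^+ p.+2 * (A ^+ 2 - a * (a * w ^+ p - d * w - h * u))).
Proof.
rewrite [(X ^+ 2 * w) ^+ p]exprMn [(X ^+ p * A) ^+ 2]exprMn -!exprM.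
have -> : X ^+ (p * 2) = X ^+ (p - 2) * X ^+ (p - 2) * X ^+ 4.
  by rewrite -!exprD; congr (_ ^+ _); lia.
have -> : X ^+ (2 * p) = X ^+ (p - 2) * X ^+ (p - 2) * X ^+ 4.
  by rewrite -!exprD; congr (_ ^+ _); lia.
have -> : X ^+ (2 * p - 2) = X ^+ (p - 2) * X ^+ (p - 2) * X ^+ 2.
  by rewrite -!exprD; congr (_ ^+ _); lia.
have -> : X ^+ (2 * p - 1) = X ^+ (p - 2) * X ^+ (p - 2) * X ^+ 3.
  by rewrite -!exprD; congr (_ ^+ _); lia.
have -> : X ^+ p.+2 = X ^+ (p - 2) * X ^+ 4 by rewrite -!exprD; congr (_ ^+ _); lia.
by ring.
Qed.

(** The combination of w^p, w and u that [trans_f2] makes invariant when u moves to u + s and w to w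
    - t. *)
Definition lin_h : {poly R} :=
  cst g12 * lin_delta ^+ p - cst g14 * lin_delta - cst g24 * 'X.

Definition lin_f2 : {poly R} := cst 2^-1 * (A ^+ 2 - cst g12 * lin_h).

Lemma lin_map_f2 : lin_map (f2bar p c) = X ^+ p.+2 * lin_f2.
Proof.
have X0 : X != 0 by rewrite polyC_eq0 -msupp_eq0 msuppX.
have two0 := two_neq0 p_gt2 charFp.
have E2 : cst 2 * cst 2^-1 = 1 by rewrite -!rmorphM /= mulfV.
have E2' : cst 2^-1 * cst 2 = 1 by rewrite mulrC.
have := congr1 lin_map (f2barE c p_prime p_gt2 charFp).
rewrite lin_mapZ rmorphM rmorphXn /= lin_map_var => /(congr1 ( *%R (cst 2^-1))).
rewrite mulrA E2' mul1r => E; apply: (mulfI (expf_neq0 (p - 2) X0)); rewrite {}E.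
rewrite /f2bar_num !rmorphD rmorphN /= !lin_mapZ !(rmorphXn, rmorphM) /= lin_map_f1.
rewrite lin_map_delta !lin_map_var /lin_f2 /lin_h.
by rewrite f2bar_num_factor // [LHS]mulrCA [in LHS](mulrCA (cst 2^-1)).
Qed.

Lemma lin_delta_shift s t : g12 * s ^+ p - g13 * t + g23 * s = 0 ->
  lin_delta \Po ('X + cst s) = lin_delta - cst t.
Proof.
move=> E; have -> : t = g13^-1 * (g12 * s ^+ p + g23 * s).
  apply: (mulfI gamma13_neq0); rewrite mulrA mulfV // mul1r; apply/esym/eqP.
  by rewrite -subr_eq0 -E; apply/eqP; ring.
have charR : p \in [pchar {poly R}].
  by exact: (rmorph_pchar (polyC \o @mpolyC 2 F) charFp).
rewrite /lin_delta comp_polyM !comp_polyB !comp_polyM !comp_polyC.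
rewrite comp_Xn_poly comp_polyX.
rewrite -[('X + _) ^+ p](pFrobenius_autE charR) pFrobenius_autD_comm; last exact: mulrC.
rewrite !pFrobenius_autE !(rmorphM, rmorphD, rmorphXn) /=.
by move: ('X) ('X ^+ p) A (cst s) (cst g12) (cst g23) (cst g13^-1) => u v w s' a e b; ring.
Qed.

Lemma lin_z_shift s t : g12 * s ^+ p - g13 * t + g23 * s = 0 ->
  lin_z \Po ('X + cst s) = lin_z + cst (2 * s) * 'X + cst (s ^+ 2 + t).
Proof.
move=> /lin_delta_shift E; rewrite /lin_z comp_polyB E comp_Xn_poly.
rewrite !(rmorphD, rmorphM, rmorphXn) /= ?rmorph_nat.
by move: ('X) (cst s) (cst t) lin_delta => u s' t' w; ring.
Qed.

(** Both sides are ring morphisms in [f], so the three variables suffice. By [trans_f1], translating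
    u by s moves w to w - t, which matches the action on z. *)
Lemma lin_map_shear f (g : 'Z_p * 'Z_p) :
  lin_map (f \mPo shear (trans_s c g) (trans_t c g)) =
  lin_map f \Po ('X + cst (trans_s c g)).
Proof.
have := trans_f1 c charFp g; move: (trans_s c g) (trans_t c g) => s t Est.
apply: (mpoly_rmorph_ext (f := lin_map \o comp_mpoly (shear s t))
  (g := comp_poly ('X + cst s) \o lin_map)) => [a|i] /=.
  by rewrite comp_mpolyC !lin_mapC comp_polyC.
case: i => [[|[|[|//]]] lti].
- have -> : Ordinal lti = 0 by apply: val_inj.
  by rewrite shear_vx lin_map_var comp_polyC.
- have -> : Ordinal lti = 1 by apply: val_inj.
  rewrite shear_vy rmorphD /= lin_mapZ !lin_map_var comp_polyM comp_polyC comp_polyX.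
  by rewrite mulrDr [cst s * _]mulrC.
have -> : Ordinal lti = 2 by apply: val_inj.
rewrite shear_vz !rmorphD /= !lin_mapZ !lin_map_var comp_polyM comp_polyC (lin_z_shift Est).
by rewrite !mulrDr [cst (s ^+ 2 + t) * _]mulrC [cst (2 * s) * _]mulrCA.
Qed.

Lemma size_lin_delta : size lin_delta = p.+1 /\
  lead_coef lin_delta = (- (g13^-1 * g12))%:MP.
Proof.
have -> : lin_delta = cst (- (g13^-1 * g12)) * 'X ^+ p
    + cst g13^-1 * (A - cst g23 * 'X).
  by rewrite /lin_delta !(rmorphN, rmorphM) /=; ring.
apply: size_lead_CXnD; first by rewrite mpolyC_neq0 // oppr_eq0 mulf_neq0 ?invr_eq0.
rewrite size_Cmul ?mpolyC_neq0 ?invr_eq0 //.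
rewrite (leq_trans (size_polyD _ _)) // geq_max size_polyN.
rewrite (leq_trans (size_polyC_leq1 _)) ?(ltnW (ltnW p_gt2)) //=.
by rewrite (leq_trans (size_polyMleq _ _)) // size_polyX addn2 /= (leq_ltn_trans (size_polyC_leq1 _)) // ltnW.
Qed.

Lemma size_lin_z : size lin_z = p.+1 /\ lead_coef lin_z = (g13^-1 * g12)%:MP.
Proof.
have [sz lc] := size_lin_delta; rewrite /lin_z addrC.
(* Here p > 2 lets the u^p of [lin_delta] outrank u^2. *)
have lt : (size ('X^2 : {poly R})%R < size (- lin_delta)%R)%N by rewrite size_polyN sz size_polyXn.
by rewrite size_polyDl // lead_coefDl // size_polyN lead_coefN sz lc -rmorphN opprK.
Qed.

Lemma size_lin_f2 : exists2 k, k != 0 &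
  size lin_f2 = (p * p).+1 /\ lead_coef lin_f2 = k%:MP.
Proof.
have [sz lc] := size_lin_delta; have two0 := two_neq0 p_gt2 charFp.
(* [k0] is the coefficient of w^p in [lin_f2], and [k1] is the p-th power of the lead coefficient of
   w in u; the rest has degree at most p in u. *)
pose k0 := - (2^-1 * (g12 * g12)); pose k1 := (- (g13^-1 * g12)) ^+ p.
have k00 : k0 != 0 by rewrite oppr_eq0 !mulf_neq0 ?invr_eq0.
have k10 : k1 != 0 by rewrite expf_neq0 // oppr_eq0 mulf_neq0 ?invr_eq0.
exists (k0 * k1); first by rewrite mulf_neq0.
pose q := cst 2^-1 * (A ^+ 2 + cst g12 * (cst g14 * lin_delta + cst g24 * 'X)).
have -> : lin_f2 = cst k0 * lin_delta ^+ p + q.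
  rewrite /lin_f2 /lin_h /q /k0 !(rmorphN, rmorphM) /=.
  move: (cst 2^-1) (cst g12) (cst g14) (cst g24) A lin_delta ('X) => t a d h A' w u.
  by ring.
have szw : size (lin_delta ^+ p) = (p * p).+1.
  have w0 : lin_delta ^+ p != 0 by rewrite expf_neq0 // -size_poly_gt0 sz.
  by rewrite (polySpred w0) size_exp sz.
have szk : size (cst k0 * lin_delta ^+ p) = (p * p).+1 by rewrite size_Cmul ?mpolyC_neq0.
have szq : (size q < (p * p).+1)%N.
  have szC (r : R) : (size r%:P <= p.+1)%N by rewrite (leq_trans (size_polyC_leq1 _)).
  have szCM (r : R) (g : {poly R}) : (size g <= p.+1 -> size (r%:P * g)%R <= p.+1)%N.
    by move=> szg; rewrite mul_polyC (leq_trans (size_scale_leq _ _)).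
  have szD (g h : {poly R}) : (size g <= p.+1 -> size h <= p.+1 -> size (g + h)%R <= p.+1)%N.
    by move=> szg szh; rewrite (leq_trans (size_polyD _ _)) // geq_max szg.
  apply: (@leq_trans p.+2); last by rewrite ltnS; nia.
  rewrite ltnS; apply/szCM/szD; first by rewrite -rmorphXn; apply: szC.
  apply/szCM/szD; apply: szCM; first by rewrite sz.
  by rewrite size_polyX; lia.
rewrite size_polyDl ?szk // lead_coefDl ?szk //; split=> //.
by rewrite lead_coefM lead_coefC lead_coef_exp lc rmorphM rmorphXn.
Qed.

Definition lin_norm : {poly R} :=
  \prod_(g : 'Z_p * 'Z_p) (lin_z \Po ('X + cst (trans_s c g))).

Lemma lin_map_norm : lin_map (orbit_norm p c z) = X ^+ (p * p) * lin_norm.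
Proof.
rewrite orbit_normE // rmorph_prod /= /lin_norm -(card_group p_prime).
rewrite -prodr_const -big_split; apply: eq_bigr => g _ /=.
by rewrite VM_act_shear // lin_map_shear // lin_map_var comp_polyM comp_polyC.
Qed.

Lemma size_lin_norm : (size lin_norm = (p * (p * p)).+1)%N /\
  lead_coef lin_norm = ((g13^-1 * g12) ^+ (p * p))%:MP.
Proof.
have [sz lc] := size_lin_z.
have szg g : size (lin_z \Po ('X + cst (trans_s c g))) = p.+1.
  by rewrite size_comp_poly2 ?size_XaddC.
split.
  rewrite /lin_norm size_prod => [|g _]; last by rewrite -size_poly_gt0 szg.
  rewrite (eq_bigr (fun=> p.+1)) // sum_nat_const card_group //; nia.
rewrite /lin_norm lead_coef_prod (eq_bigr (fun=> (g13^-1 * g12)%:MP)) => [|g _].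
  by rewrite prodr_const card_group // rmorphXn.
by rewrite lead_coef_comp ?size_XaddC // lc lead_coefXaddC expr1n mulr1.
Qed.

(** An instance of [shift_invariant_comp] with p^2 distinct translations and [lin_f2] made monic;
    [lin_f2] inherits invariance from [f2bar] by cancelling x^(p+2). *)
Lemma invariant_comp_lin_f2 (g : {poly R}) :
  (forall s, g \Po ('X + cst (trans_s (p := p) c s)) = g) ->
  exists q, g = q \Po lin_f2.
Proof.
move=> inv_g; have [k k0 [sz lc]] := size_lin_f2.
pose D := cst k^-1 * lin_f2.
pose r : seq R := [seq (trans_s c s)%:MP | s : 'Z_p * 'Z_p].
have szr : size r = (p * p)%N by rewrite size_image card_group.
have X0 : X != 0 by rewrite polyC_eq0 -msupp_eq0 msuppX.
have [||||_ /imageP[s _ ->]|_ /imageP[s _ ->]|q eq_g] := @shift_invariant_comp _ D g r.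
- by rewrite monicE /D lead_coefM lead_coefC lc -rmorphM /= mulVf.
- rewrite map_inj_uniq ?enum_uniq // => s t /(fmorph_inj (@mpolyC 2 F)).
  exact: trans_s_inj.
- by rewrite szr muln_gt0 prime_gt0.
- by rewrite szr /D size_Cmul ?mpolyC_neq0 ?invr_eq0.
- rewrite /D comp_polyM comp_polyC; congr (_ * _).
  apply: (mulfI (expf_neq0 p.+2 X0)); rewrite -lin_map_f2 //.
  rewrite -[in RHS](invariantsP s (f2bar_inv c p_prime p_gt2 charFp)).
  by rewrite lin_map_shear // lin_map_f2 // [RHS]comp_polyM -polyC_exp comp_polyC.
- exact: inv_g.
exists (q \Po (cst k^-1 * 'X)); rewrite eq_g -comp_polyA comp_polyM comp_polyC.
by rewrite comp_polyX.
Qed.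

Local Notation b := (basisV p c).
Local Notation i0 := (0%R : 'I_4).
Local Notation i1 := (1%R : 'I_4).
Local Notation i2 := (2%R : 'I_4).
Local Notation i3 := (3%R : 'I_4).

Lemma comp_basis_var : ('X_i0 \mPo b = x) * ('X_i1 \mPo b = f1bar p c) *
  ('X_i2 \mPo b = f2bar p c) * ('X_i3 \mPo b = orbit_norm p c z).
Proof. by rewrite !comp_mpolyXU. Qed.

(** Since A = f1 / x^p, each factor A costs x^p; T_2 does not enter. *)
Lemma lin_map_lift_coef (r : R) : exists K P,
  bounded i2 1 P /\ X ^+ K * r%:P = lin_map (P \mPo b).
Proof.
rewrite [r]mpolyE; elim/big_rec: _ => [|m s _ [K [P [bP eP]]]].
  by exists 0%N, 0; split; [apply: bounded0|rewrite comp_mpoly0 !rmorph0 mulr0].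
pose Q : {mpoly F[4]} := 'X_i0 ^+ m 0 * ('X_i1 ^+ m 1 * (r@_m)%:MP).
have bQ : bounded i2 1 Q.
  apply: boundedXnM => //; apply: boundedXnM => //.
  by rewrite -alg_mpolyC -mpolyX0; apply/boundedZ/boundedX; rewrite mnm0E.
have eQ : X ^+ (p * m 1) * (r@_m *: 'X_[m])%:P = lin_map (Q \mPo b).
  rewrite /Q !rmorphM !rmorphXn /= !comp_basis_var comp_mpolyC ?rmorphM ?rmorphXn /=.
  have eX : 'X_[m] = 'X_0 ^+ m 0 * 'X_1 ^+ m 1 :> R.
    rewrite mpolyXE_id !big_ord_recl big_ord0 mulr1.
    by have -> : lift ord0 ord0 = 1 :> 'I_2 by apply: val_inj.
  rewrite lin_map_var lin_map_f1 // lin_mapC -mul_mpolyC eX !polyCM !polyC_exp.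
  rewrite [(X ^+ p * A) ^+ _]exprMn -exprM.
  by move: (X ^+ m 0) (X ^+ (p * m 1)) (A ^+ m 1) (cst r@_m) => u v w k; ring.
clearbody Q; exists (K + p * m 1%R)%N, ('X_i0 ^+ K * Q + 'X_i0 ^+ (p * m 1) * P); split.
  by apply: boundedD; apply: boundedXnM.
rewrite comp_mpolyD !(rmorphD, rmorphM) /= -eP -eQ !rmorphXn /= comp_basis_var.
rewrite ?rmorphXn /= lin_map_var exprD; move: (X ^+ K) (X ^+ _) => u v; ring.
Qed.

(** Horner recursion on [q]: each factor [lin_f2] costs x^(p+2) and raises the exponent of T_2 by
    one. *)
Lemma lin_map_lift d (q : {poly R}) : (size q <= d)%N -> exists K P,
  bounded i2 d P /\ X ^+ K * (q \Po lin_f2) = lin_map (P \mPo b).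
Proof.
elim: d q => [|d IHd] q.
  rewrite leqn0 size_poly_eq0 => /eqP->; exists 0%N, 0; split; first exact: bounded0.
  by rewrite comp_poly0 comp_mpoly0 rmorph0 mulr0.
move=> szq; have [q' [r [eq_q szq']]] : exists q' r, q = q' * 'X + r%:P /\ (size q' <= d)%N.
  exists (drop_poly 1 q), q`_0; rewrite size_drop_poly leq_subLR; split=> //.
  have <- : take_poly 1 q = (q`_0)%:P.
    by apply/polyP => i; rewrite coef_take_poly coefC; case: i.
  by rewrite addrC poly_take_drop.
have [K1 [P1 [b1 e1]]] := IHd q' szq'; have [K2 [P2 [b2 e2]]] := lin_map_lift_coef r.
exists (K1 + K2 + p.+2)%N, ('X_i0 ^+ K2 * ('X_i2 * P1) + 'X_i0 ^+ (K1 + p.+2) * P2).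
split.
  apply: boundedD; apply: boundedXnM => //; first exact: boundedUM.
  exact: boundedW b2.
rewrite eq_q comp_poly_MXaddC comp_mpolyD !(rmorphD, rmorphM) /= -e1 -e2.
rewrite !rmorphXn /= !comp_basis_var ?rmorphXn /= lin_map_var lin_map_f2 // !exprD.
by move: (X ^+ K1) (X ^+ K2) (X ^+ p.+2) => u v w; ring.
Qed.

Lemma f2bar_exp_normal : exists2 N, bounded i2 p N & f2bar p c ^+ p = N \mPo b.
Proof.
have [szN lcN] := size_lin_norm.
have [k k0 [szC lcC]] := size_lin_f2.
have X0 : X != 0 by rewrite polyC_eq0 -msupp_eq0 msuppX.
have [s|q eq_q] := @invariant_comp_lin_f2 lin_norm.
  apply: (mulfI (expf_neq0 (p * p) X0)); rewrite -lin_map_norm //.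
  rewrite -[in RHS](invariantsP s (orbit_norm_inv p_prime p_gt2 charFp gamma13_neq0)).
  by rewrite lin_map_shear // lin_map_norm // [RHS]comp_polyM -polyC_exp comp_polyC.
(* Comparing degrees in u gives p^3 = (deg q) p^2. *)
have szq : size q = p.+1.
  have := size_comp_poly q lin_f2; rewrite -eq_q szN szC /= => /eqP.
  rewrite eqn_pmul2r ?muln_gt0 ?prime_gt0 // => /eqP eqp.
  by rewrite eqp prednK // size_poly_gt0; apply: contra_eq_neq szN => q0; rewrite eq_q q0 comp_poly0 size_poly0.
(* Comparing lead coefficients: that of [q] times k^p is that of [lin_norm], a constant of F. *)
have [k1 k10 lcq] : exists2 k1, k1 != 0 & lead_coef q = k1%:MP.
  exists ((g13^-1 * g12) ^+ (p * p) * (k ^+ p)^-1).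
    by rewrite mulf_neq0 ?invr_eq0 ?expf_neq0 ?mulf_neq0 ?invr_eq0.
  have kp0 : (k ^+ p)%:MP != 0 :> R by rewrite mpolyC_neq0 ?expf_neq0.
  apply: (mulIf kp0); rewrite -rmorphM /= mulfVK ?expf_neq0 // -lcN eq_q.
  by rewrite lead_coef_comp ?szC ?ltnS ?muln_gt0 ?prime_gt0 // lcC szq rmorphXn.
have [K [P [bP eP]]] : exists K P, bounded i2 p P /\
    X ^+ K * (take_poly p q \Po lin_f2) = lin_map (P \mPo b).
  by apply: lin_map_lift; rewrite size_take_poly.
have eq2 : q = cst k1 * 'X^p + take_poly p q.
  apply/polyP => i; rewrite coefD coefCM coefXn coef_take_poly.
  case: ltngtP => [ip|ip|->]; rewrite ?mulr0 ?mulr1 ?add0r ?addr0 //.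
    by rewrite nth_default // szq.
  by rewrite -lcq lead_coefE szq.
(* The witness comes from [exp_relation]: [lin_norm] is [k1] times the p-th power of [lin_f2] plus
   lower terms, solved for that power, with powers of x clearing all denominators. *)
apply: (@normal_vxX_div _ _ _ p_prime p_gt2 charFp gamma12_neq0 gamma13_neq0 (K + p * p) _
  (k1^-1 *: ('X_i0 ^+ (K + p * p.+2) * 'X_i3 - 'X_i0 ^+ (p * p + p * p.+2) * P))).
  apply/boundedZ/boundedD; last rewrite -scaleN1r; last apply: boundedZ.
    by apply: boundedXnM => //; apply: boundedX; rewrite mnm1E prime_gt0.
  exact: boundedXnM.
have eN : lin_norm = cst k1 * lin_f2 ^+ p + (take_poly p q \Po lin_f2).
  by rewrite eq_q {1}eq2 comp_polyD comp_polyM comp_polyC comp_Xn_poly.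
have k1V : cst k1^-1 * cst k1 = 1 by rewrite -!rmorphM /= mulVf.
apply: lin_map_inj; rewrite comp_mpolyZ lin_mapZ comp_mpolyB.
rewrite rmorphB !rmorphM !rmorphXn /= !comp_basis_var lin_map_var lin_map_f2 // lin_map_norm //.
exact: exp_relation k1V eN eP.
Qed.

Lemma invariants_normal f : f \in invariants p c ->
  exists2 P, bounded i2 p P & f = P \mPo b.
Proof.
move=> inv_f; have [N bN eN] := f2bar_exp_normal.
have [s|q eq_q] := @invariant_comp_lin_f2 (lin_map f).
  apply: etrans (congr1 lin_map (invariantsP s inv_f)).
  exact/esym/lin_map_shear.
(* The size of [q] is arbitrary, so the T_2-exponents of [P] must be reduced below p before x^K can
   be cancelled. *)
have [K [P [_ eP]]] := lin_map_lift (leqnn (size q)).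
have [Q bQ eQ] := normal_reduce P bN eN.
apply: (@normal_vxX_div _ _ _ p_prime p_gt2 charFp gamma12_neq0 gamma13_neq0 K _ Q) => //.
rewrite -eQ; apply: lin_map_inj.
by rewrite -eP -eq_q rmorphM rmorphXn /= lin_map_var.
Qed.

End Linearization.

(** * SAGBI basis and relation *)

Section Spans.

Variables (F : fieldType) (n : nat).
Implicit Types (S : {mpoly F[n]} -> Prop) (f g : {mpoly F[n]}).

Lemma lin_spanD S f g : lin_span S f -> lin_span S g -> lin_span S (f + g).
Proof.
move=> Sf Sg; elim: Sf => [|a u v Su _ IH]; first by rewrite add0r.
by rewrite -addrA; apply: SpanStep.
Qed.

Lemma lin_spanZ S a f : lin_span S f -> lin_span S (a *: f).
Proof.
elim=> [|c u v Su _ IH]; first by rewrite scaler0; apply: SpanZero.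
by rewrite scalerDr scalerA; apply: SpanStep.
Qed.

Lemma lin_span_gen S f : S f -> lin_span S f.
Proof.
by move=> Sf; rewrite -[f]addr0 -[f]scale1r; apply: SpanStep => //; apply: SpanZero.
Qed.

Lemma lin_spanM S f g : (forall u v, S u -> S v -> S (u * v)) ->
  lin_span S f -> lin_span S g -> lin_span S (f * g).
Proof.
move=> SM Sf Sg; elim: Sf => [|a u v Su _ IH]; first by rewrite mul0r; apply: SpanZero.
rewrite mulrDl -scalerAl; apply: lin_spanD IH; apply: lin_spanZ.
elim: Sg => [|c u' v' Su' _ IH']; first by rewrite mulr0; apply: SpanZero.
by rewrite mulrDr -scalerAr; apply: SpanStep => //; apply: SM.
Qed.

Lemma subalg_genZ S a f : subalg_gen S f -> subalg_gen S (a *: f).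
Proof. by move=> Sf; rewrite -mul_mpolyC; apply: SubalgMul => //; apply: SubalgCst. Qed.

Lemma subalg_gen_lead_expo k (e : 'I_k -> 'X_{1..n}) S (m : 'X_{1..k}) :
  (forall i, S 'X_[e i]) -> subalg_gen S 'X_[lead_expo e m].
Proof.
move=> Se; rewrite /lead_expo; elim/big_rec: _ => [|i m' _ IH].
  by rewrite mpolyX0; apply: SubalgCst.
rewrite mpolyXD; apply: SubalgMul IH; rewrite -mpolyXn.
elim: (m i) => [|d IHd]; first exact: SubalgCst.
by rewrite exprS; apply: SubalgMul => //; apply: SubalgGen.
Qed.

End Spans.

Section Main.

Variables (p : nat) (F : fieldType) (c : 'M[F]_2).
Hypotheses (p_prime : prime p) (p_gt2 : (2 < p)%N) (charFp : p \in [pchar F]).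
Hypotheses (gamma12_neq0 : gammabar p c 0 1 != 0)
           (gamma13_neq0 : gammabar p c 0 2 != 0).

Local Notation g12 := (gammabar p c 0 1).
Local Notation g13 := (gammabar p c 0 2).
Local Notation b := (basisV p c).
Local Notation i1 := (1%R : 'I_4).
Local Notation i2 := (2%R : 'I_4).

Let lead_b := has_lead_basis p_prime p_gt2 charFp gamma13_neq0.
Let cst_b := basis_cst_neq0 gamma12_neq0 gamma13_neq0.

Lemma basisV_inv : {subset b <= invariants p c}.
Proof.
move=> f; rewrite !inE => /or4P[]/eqP->; first exact: vx_inv.
- exact: f1bar_inv.
- exact: f2bar_inv.
- exact: orbit_norm_inv.
Qed.

(** One inclusion is multiplicativity of lead monomials. For the other, an invariant in normal form
    has the lead monomial of one of its terms, which is a product of lead monomials of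
    generators. *)
Lemma sagbi_basisV : sagbi_basis (invariants p c) b.
Proof.
have [inv1 invZD invM] := invariants_subalg p c.
split=> [|h]; first exact: basisV_inv.
split; last first.
  elim=> [|a f g [u inv_u [u0 ->]] _ IH]; first by rewrite -(mpolyC0 3); apply: SubalgCst.
  apply: SubalgAdd IH; apply: subalg_genZ.
  have [P bP eP] := invariants_normal p_prime p_gt2 charFp gamma12_neq0 gamma13_neq0 inv_u.
  have P0 : P != 0 by apply: contraNneq u0 => P0; rewrite eP P0 comp_mpoly0.
  have [m mP lP] := has_lead_comp lead_b P0
    (bounded_expo_inj p_prime p_gt2 bP).
  have [|_ e_m] := has_lead_mon _ lP.
    by rewrite mulf_neq0 ?(lead_cst_neq0 cst_b) // -mcoeff_msupp.
  rewrite eP e_m; apply: subalg_gen_lead_expo => i; exists (tnth b i); first exact: mem_tnth.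
  by have [? ->] := has_lead_mon (cst_b i) (@lead_b i).
elim=> [f [u /basisV_inv inv_u [u0 ->]]|a|f g _ IHf _ IHg|f g _ IHf _ IHg].
- by apply: lin_span_gen; exists u.
- rewrite -alg_mpolyC; apply/lin_spanZ/lin_span_gen; exists 1 => //.
  have [|one0 ->] := has_lead_mon _ (@has_leadC F 3 1); first exact: oner_neq0.
  by rewrite mpolyX0.
- exact: lin_spanD.
apply: lin_spanM => // _ _ [u inv_u [u0 ->]] [v inv_v [v0 ->]].
exists (u * v); first exact: invM.
by rewrite mulf_neq0 // lead_monM // mpolyXD.
Qed.

Lemma subducted_exprE : subducted_expr p c \mPo b =
  g13 ^+ p *: f1bar p c ^+ (p + 2) - g12 ^+ 2 *: f2bar p c ^+ p.
Proof.
by rewrite /subducted_expr comp_mpolyB !comp_mpolyZ !rmorphXn /= !comp_basis_var.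
Qed.

(** Replacing f2^p by its normal form puts the whole expression in normal form, and normal forms
    subduct to zero. *)
Lemma subducts_subducted_expr :
  exists R, subduction_relation b (subducted_expr p c) R.
Proof.
have [N bN eN] := f2bar_exp_normal p_prime p_gt2 charFp gamma12_neq0 gamma13_neq0.
pose Q : {mpoly F[4]} := g13 ^+ p *: 'X_i1 ^+ (p + 2) - g12 ^+ 2 *: N.
have bQ : bounded i2 p Q.
  rewrite /Q -scaleNr; apply: boundedD; apply: boundedZ => //.
  by rewrite mpolyXn; apply: boundedX; rewrite mulmnE mnm1E /= prime_gt0.
have eQ : subducted_expr p c \mPo b = Q \mPo b.
  rewrite subducted_exprE /Q comp_mpolyB !comp_mpolyZ !rmorphXn /= !comp_basis_var.
  by rewrite eN.
exists (subducted_expr p c - Q), Q => //; rewrite eQ.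
apply: (subducts_to_zero_comp lead_b cst_b).
exact: (bounded_expo_inj p_prime p_gt2 bQ).
Qed.

(* Both terms of the subducted expression have lead term
   gamma13^p gamma12^(p+2) y^(p (p+2)), so they cancel. *)
Lemma subducted_expr_below :
  below (U_(1%R) *+ (p * p.+2))%MM (subducted_expr p c \mPo b).
Proof.
have e1 : (U_(1%R) *+ p *+ (p + 2) = U_(1%R) *+ (p * p.+2) :> 'X_{1..3})%MM.
  by apply/mnmP => i; rewrite !mulmnE; lia.
have e2 : (U_(1%R) *+ p.+2 *+ p = U_(1%R) *+ (p * p.+2) :> 'X_{1..3})%MM.
  by apply/mnmP => i; rewrite !mulmnE; lia.
apply: has_lead0_below; rewrite subducted_exprE -scaleNr.
have l1 := has_leadXn (p + 2) (has_lead_f1bar (c := c) p_gt2).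
have l2 := has_leadXn p (has_lead_f2bar (c := c) p_gt2 p_prime charFp).
rewrite e1 in l1; rewrite e2 in l2.
have := has_leadD (has_leadZ (g13 ^+ p) l1) (has_leadZ (- g12 ^+ 2) l2).
by have -> : g13 ^+ p * g12 ^+ (p + 2) + - g12 ^+ 2 * (g12 * g13) ^+ p = 0
  by rewrite exprMn exprD; ring.
Qed.

Lemma subduction_generates R : subduction_relation b (subducted_expr p c) R ->
  generates_relations b R.
Proof.
move=> [Q subQ eR]; have eQ := subducts_to_zeroE subQ.
have bQ : bounded i2 p Q.
  (* A T_2-exponent of at least p gives a y-exponent of at least p (p+2). The degree bound then
     forces the lead monomial to be y^(p (p+2)) itself, which is not strictly below itself. *)
  move=> m mQ; rewrite ltnNge; apply/negP => le_p.
  have lt_m := subducts_to_zero_below lead_b cst_b subQ subducted_expr_below mQ.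
  have E := lead_expoE p m.
  set M := (U_(1%R) *+ _)%MM in lt_m.
  have dM : mdeg M = (p * p.+2)%N by rewrite /M mdegMn mdeg1 mul1n.
  have dm : mdeg (lead_expo (basis_expo p) m) =
      (m 0%R + (m i1 * p + m i2 * p.+2) + m (3%R : 'I_4) * (p * p))%N.
    have o1 : lift ord0 ord0 = 1 :> 'I_3 by apply: val_inj.
    have o2 : lift ord0 (lift ord0 ord0) = 2 :> 'I_3 by apply: val_inj.
    by rewrite mdegE !big_ord_recl big_ord0 addn0 addnA o2 o1 !E.
  have le_m : (p * p.+2 <= m i2 * p.+2)%N by rewrite leq_mul2r le_p orbT.
  have le_d : (mdeg (lead_expo (basis_expo p) m) <= p * p.+2)%N.
    by move: lt_m; rewrite /grevlex_lt dM => /orP[/ltnW|/andP[/eqP-> _]].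
  suff eM : lead_expo (basis_expo p) m = M by rewrite eM grevlex_lt_irr in lt_m.
  apply/mnmP => -[[|[|[|//]]] lti]; rewrite /M mulmnE mnm1E.
  - have -> : Ordinal lti = 0 by apply: val_inj.
    by rewrite E /=; lia.
  - have -> : Ordinal lti = 1 by apply: val_inj.
    by rewrite E /=; lia.
  have -> : Ordinal lti = 2 by apply: val_inj.
  by rewrite E /=; lia.
have Rb0 : R \mPo b = 0 by rewrite eR comp_mpolyB eQ subrr.
pose N := g13 ^+ p *: 'X_i1 ^+ (p + 2) - Q.
have bN : bounded i2 p N.
  rewrite /N -scaleN1r; apply: boundedD; apply: boundedZ => //.
  by rewrite mpolyXn; apply: boundedX; rewrite mulmnE mnm1E /= prime_gt0.
(* As [Q] and the power of T_1 are normal forms, T_2^p survives in [R] with a nonzero constant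
   coefficient, so [bounded_div] applies. *)
have eRN : R = - g12 ^+ 2 *: 'X_i2 ^+ p + N.
  by rewrite eR /subducted_expr /N scaleNr addrAC addrC addrA.
have a0 : - g12 ^+ 2 != 0 by rewrite oppr_eq0 expf_neq0.
move=> P; split=> [Pb0|[S ->]]; last by rewrite rmorphM /= Rb0 mulr0.
have [S [P' [eP bP']]] := bounded_div P a0 bN.
exists S; rewrite eP -eRN.
(* The remainder is a normal form that vanishes on the generators. *)
suff -> : P' = 0 by rewrite addr0.
apply: (comp_mpoly_inj lead_b cst_b); first exact: (bounded_expo_inj p_prime p_gt2 bP').
by move: Pb0; rewrite eP -eRN comp_mpolyD rmorphM /= Rb0 mulr0 add0r.
Qed.

End Main.

Unset Implicit Arguments.

Theorem theorem7p3 (p : nat) (F : fieldType) (c : 'M[F]_2)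
    (p_prime : prime p) (p_gt2 : (2 < p)%N) (charFp : p \in [pchar F])
    (gamma12_neq0 : gammabar p c 0 1 != 0)
    (gamma13_neq0 : gammabar p c 0 2 != 0) :
  sagbi_basis (invariants p c) (basisV p c) /\
  ((exists R, subduction_relation (basisV p c) (subducted_expr p c) R) /\
   (forall R, subduction_relation (basisV p c) (subducted_expr p c) R ->
              generates_relations (basisV p c) R)).
Proof.
split; first exact: sagbi_basisV.
split; first exact: subducts_subducted_expr.
by move=> R; exact: subduction_generates.
Qed.
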